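(* Let $M\subset\mathbb C^2$ be a domain, $F$ the field of meromorphic functions on $M$, and $T\in F[d_x,d_y]$ a separable linear partial differential operator of order $n$ with symbol $\prod_{1\le i\le n}(\xi-a_i\eta)$, where $a_1,\dots,a_n\in F$ are pairwise distinct. Then there is an analytic subvariety $S\subset M$ of dimension $1$ such that for every point $(x_0,y_0)\in M\setminus S$ the following holds: there exist fractional-derivatives series solutions of $T=0$ $$h_{0,i}G^{(0)}(f_i)+h_{1,i}G^{(-1)}(f_i)+h_{2,i}G^{(-2)}(f_i)+\cdots,\qquad 1\le i\le n,$$ with $f_i,h_{j,i}\in\mathbb C[[x-x_0,y-y_0]]$ normalized at $(x_0,y_0)$ as in the context, and for fixed such $f_i$ and $h_{j,i}$ the sum of the $n$ spaces of specializations of these series, $i=1,\dots,n$, coincides with the space of all solutions of $T=0$ in formal power series in $x-x_0,\,y-y_0$.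
   Context: $d_x,d_y$ are the partial derivatives; for $T=\sum_{i+j\le n}b_{i,j}d_x^id_y^j$ of order $n$ the symbol is $\sum_{i+j=n}b_{i,j}\xi^i\eta^j$. $T$ is separable if its symbol is a product of $n$ pairwise non-proportional linear forms; it is normalized here (after, if necessary, a constant linear change of $d_x,d_y$ and dividing by a coefficient) to be $\prod_i(\xi-a_i\eta)$. For each $i$, $G^{(s)}(f_i)$, $s\in\mathbb Z$, are formal symbols with $dG^{(s)}(f_i)=(df_i)G^{(s+1)}(f_i)$ for $d\in\{d_x,d_y\}$; a series $\sum_{l\ge0}h_{l,i}G^{(-l)}(f_i)$ is a solution of $T=0$ if applying $T$ termwise by the Leibniz rule gives zero coefficient at every $G^{(s)}(f_i)$. Normalization at $(x_0,y_0)$ (where all coefficients of $T$ are defined): $f_i$ is a power series with $d_xf_i-a_id_yf_i=0$, zero free coefficient $f_i(x_0,y_0)=0$ and $(d_xf_i,d_yf_i)(x_0,y_0)\ne(0,0)$ (so $d_yf_i(x_0,y_0)\neq0$); the $h_{l,i}$ are power series such that the series $\sum_{l\ge0}h_{l,i}G^{(-l)}(f_i)$ is a solution of $T=0$, and $h_{0,i}(x_0,y_0)\ne0$. The space of specializations of the $i$-th series $\sum_{l\ge0}h_{l,i}G^{(-l)}(f_i)$ is the set of all power series obtained by substituting $$G^{(-l)}(f_i)=\sum_{j\ge0}c_{j}\frac{f_i^{\,j+l}}{(j+l)!},\qquad l=0,1,2,\dots,$$ with arbitrary sequences $(c_j)_{j\ge0}$, $c_j\in\mathbb C$; i.e. all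 series $\sum_{l\ge0}h_{l,i}\sum_{j\ge0}c_jf_i^{\,j+l}/(j+l)!$. *)

(* Defs.v *)
From HB Require Import structures.
From mathcomp Require Import all_boot all_order all_algebra.
From mathcomp Require Import complex.
From mathcomp Require Import boolp classical_sets functions reals topology.
From mathcomp Require Import normedtype sequences.

Set Implicit Arguments.
Unset Strict Implicit.
Unset Printing Implicit Defensive.

Import Order.TTheory GRing.Theory Num.Theory.
Import numFieldNormedType.Exports.

Local Open Scope classical_set_scope.
Local Open Scope complex_scope.
Local Open Scope ring_scope.

(* The usual topology of C = R[i], i.e. the one of the norm `|z|; it is the
   instance that every numClosedFieldType carries. *)
HB.instance Definition _ (R : rcfType) :=
  NormedModule.copy R[i] (R[i] : numClosedFieldType).

(* ------------------------ formal power series ---------------------------- *)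

(* K[[X, Y]]: [u i j] is the coefficient of X^i Y^j. For series at (x0, y0),
   X = x - x0 and Y = y - y0. *)
Definition fps (K : fieldType) : Type := nat -> nat -> K.

Definition fps_one (K : fieldType) : fps K :=
  fun i j => ((i == 0%N) && (j == 0%N))%:R.

Definition fps_mul (K : fieldType) (u v : fps K) : fps K := fun i j =>
  \sum_(k < i.+1) \sum_(l < j.+1) u k l * v (i - k)%N (j - l)%N.

Definition fps_exp (K : fieldType) (u : fps K) (m : nat) : fps K :=
  iter m (fps_mul u) (fps_one K).

Definition fps_scale (K : fieldType) (c : K) (u : fps K) : fps K :=
  fun i j => c * u i j.

Definition fps_dx (K : fieldType) (u : fps K) : fps K :=
  fun i j => u i.+1 j *+ i.+1.

Definition fps_dy (K : fieldType) (u : fps K) : fps K :=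
  fun i j => u i j.+1 *+ j.+1.

(* s is the sum of the u_k for the (X, Y)-adic topology. *)
Definition fps_sums_to (K : fieldType) (u : nat -> fps K) (s : fps K) : Prop :=
  forall i j, \forall N \near \oo, \sum_(k < N) u k i j = s i j.

(* T u, for T = \sum_(i + j <= n) b_{i,j} d_x^i d_y^j. *)
Definition fps_op (K : fieldType) (n : nat) (b : nat -> nat -> fps K)
    (u : fps K) : fps K := fun k l =>
  \sum_(i < n.+1) \sum_(j < n.+1 | (i + j <= n)%N)
    fps_mul (b i j) (iter i (@fps_dx K) (iter j (@fps_dy K) u)) k l.

Definition fps_solution (K : fieldType) (n : nat) (b : nat -> nat -> fps K)
    (u : fps K) : Prop :=
  forall k l, fps_op n b u k l = 0.

(* ------------------- fractional-derivatives series ----------------------- *)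

(* Formal sums \sum_(s in Z) g_s G^(s)(f), with g_s in K[[X, Y]]. *)
Definition gser (K : fieldType) : Type := int -> fps K.

(* The derivation extending d, d in {d_x, d_y}, by
   d (g G^(s)(f)) = (d g) G^(s)(f) + g (d f) G^(s+1)(f). *)
Definition gser_der (K : fieldType) (d : fps K -> fps K) (f : fps K)
    (g : gser K) : gser K := fun s k l =>
  d (g s) k l + fps_mul (d f) (g (s - 1)) k l.

Definition gser_op (K : fieldType) (n : nat) (b : nat -> nat -> fps K)
    (f : fps K) (g : gser K) : gser K := fun s k l =>
  \sum_(i < n.+1) \sum_(j < n.+1 | (i + j <= n)%N)
    fps_mul (b i j)
      (iter i (gser_der (@fps_dx K) f) (iter j (gser_der (@fps_dy K) f) g) s)
      k l.

(* \sum_(l >= 0) h_l G^(-l)(f). *)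
Definition frac_series (K : fieldType) (h : nat -> fps K) : gser K :=
  fun s => if s <= 0 then h (absz s) else (fun _ _ => 0).

Definition frac_solution (K : fieldType) (n : nat) (b : nat -> nat -> fps K)
    (f : fps K) (h : nat -> fps K) : Prop :=
  forall s k l, gser_op n b f (frac_series h) s k l = 0.

Definition normalized_solution (K : fieldType) (n : nat)
    (b : nat -> nat -> fps K) (a f : fps K) (h : nat -> fps K) : Prop :=
  [/\ forall k l, fps_dx f k l - fps_mul a (fps_dy f) k l = 0,
      f 0%N 0%N = 0,
      (fps_dx f 0%N 0%N, fps_dy f 0%N 0%N) <> (0, 0),
      frac_solution n b f h
    & h 0%N 0%N 0%N <> 0].

(* The space of specializations: G l is the value given to G^(-l)(f). Both
   infinite sums converge as soon as f has zero free coefficient. *)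
Definition specialization (K : fieldType) (f : fps K) (h : nat -> fps K)
    (u : fps K) : Prop :=
  exists (c : nat -> K) (G : nat -> fps K),
    (forall l, fps_sums_to
       (fun j => fps_scale (c j / ((j + l)`!)%:R) (fps_exp f (j + l))) (G l)) /\
    fps_sums_to (fun l => fps_mul (h l) (G l)) u.

(* ----------------- holomorphic functions of two variables ---------------- *)

Definition fps_psum (R : realType) (c : fps R[i]) (z : R[i] * R[i])
    (N : nat) : R[i] :=
  \sum_(i < N) \sum_(j < N) c i j * z.1 ^+ i * z.2 ^+ j.

(* The power series c converges absolutely near p and its sum is f on D
   near p. The square partial sums alone could converge pointwise without the
   double series converging, hence the first clause. *)
Definition taylor (R : realType) (D : set (R[i] * R[i]))
    (f : R[i] * R[i] -> R[i]) (p : R[i] * R[i]) (c : fps R[i]) : Prop :=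
  (exists2 r : R[i], 0 < r & exists B : R[i], forall N : nat,
     \sum_(i < N) \sum_(j < N) `|c i j| * r ^+ (i + j) <= B) /\
  (\forall q \near p, D q -> fps_psum c (q - p) @ \oo --> f q).

Definition holomorphic_on (R : realType) (U : set (R[i] * R[i]))
    (f : R[i] * R[i] -> R[i]) : Prop :=
  forall p, U p -> exists c, taylor setT f p c.

(* -------------------------- analytic subvarieties ------------------------ *)

Definition analytic_subset (R : realType) (M S : set (R[i] * R[i])) : Prop :=
  S `<=` M /\
  forall p, M p -> exists (U : set (R[i] * R[i])) (m : nat)
      (g : 'I_m -> R[i] * R[i] -> R[i]),
    [/\ open_nbhs p U, forall i, holomorphic_on U (g i)
      & forall q, U q -> (S q <-> forall i, g i q = 0)].

(* Near p, S is a complex submanifold of C^2 of dimension d: it is cut out by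
   k = 2 - d holomorphic equations with independent differentials at p. *)
Definition regular_point (R : realType) (d : nat) (S : set (R[i] * R[i]))
    (p : R[i] * R[i]) : Prop :=
  S p /\
  exists (k : nat) (U : set (R[i] * R[i])) (g : 'I_k -> R[i] * R[i] -> R[i])
      (c : 'I_k -> fps R[i]),
    (k + d = 2)%N /\
    [/\ open_nbhs p U, forall i, holomorphic_on U (g i),
        forall i, taylor setT (g i) p (c i),
        row_free (\matrix_(i < k, j < 2)
          (if j == 0 then c i 1%N 0%N else c i 0%N 1%N))
      & forall q, U q -> (S q <-> forall i, g i q = 0)].

Definition has_dimension (R : realType) (S : set (R[i] * R[i]))
    (d : nat) : Prop :=
  (exists p, regular_point d S p) /\
  (forall e p, regular_point e S p -> (e <= d)%N).

(* -------------------------- meromorphic functions ------------------------ *)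

Definition domain (R : realType) (M : set (R[i] * R[i])) : Prop :=
  [/\ open M, connected M & M !=set0].

(* A meromorphic function on M: a holomorphic function on the complement of a
   nowhere dense analytic subset of M which, near each point of M, is a quotient
   of holomorphic functions. The values on [polar] are irrelevant, and [polar]
   need not be minimal, so elements of the field of meromorphic functions are
   these objects up to [mero_eq]. *)
Record meromorphic (R : realType) (M : set (R[i] * R[i])) : Type :=
  Meromorphic {
    polar : set (R[i] * R[i]);
    mero_val :> R[i] * R[i] -> R[i];
    _ : analytic_subset M polar;
    _ : interior polar = set0;
    _ : holomorphic_on (M `\` polar) mero_val;
    _ : forall p, M p -> exists (U : set (R[i] * R[i]))
          (g h : R[i] * R[i] -> R[i]),
        [/\ open_nbhs p U, holomorphic_on U g, holomorphic_on U h
          & forall q, U q -> ~ polar q ->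
              h q <> 0 /\ mero_val q = g q / h q]
  }.

Definition mero_eq (R : realType) (M : set (R[i] * R[i]))
    (a b : meromorphic M) : Prop :=
  forall q, M q -> ~ polar a q -> ~ polar b q -> a q = b q.

(* a is holomorphic at p, possibly after removing a singularity, with Taylor
   series c there; c is unique since [polar a] is nowhere dense. *)
Definition mero_taylor (R : realType) (M : set (R[i] * R[i]))
    (a : meromorphic M) (p : R[i] * R[i]) (c : fps R[i]) : Prop :=
  taylor (~` polar a) a p c.

(* \sum_(i + j = n) b_{i,j} xi^i eta^j = \prod_i (xi - a_i eta), with xi = 'X
   and eta = 'X%:P in C[eta][xi]. *)
Definition has_symbol (R : realType) (M : set (R[i] * R[i])) (n : nat)
    (b : nat -> nat -> meromorphic M) (a : 'I_n -> meromorphic M) : Prop :=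
  forall q, M q ->
    (forall i j, (i + j = n)%N -> ~ polar (b i j) q) ->
    (forall i, ~ polar (a i) q) ->
    \sum_(i < n.+1) (b i (n - i)%N q)%:P%:P * 'X ^+ i * ('X%:P) ^+ (n - i) =
    \prod_(i < n) ('X - (a i q)%:P%:P * 'X%:P) :> {poly {poly R[i]}}.

(* Main.v *)
(** Off the poles of the coefficients and of the [a_i], and off the points where
    two of the [a_i] agree, everything is formal.  With [f] a solution of
    [d_x f = a_i d_y f], the coefficient of [G^(n)(f)] in [T] applied to a
    series vanishes, and the next ones are transport equations
    [w (d_x h_l - a_i d_y h_l) + kappa h_l = known], where [w] is a unit because
    [a_i] is a simple root of the symbol; they are solved successively.

    Conversely, if a solution [u] vanishes to order [m] at the point, its form
    of degree [m] is killed by the constant coefficient operator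
    [prod_i (d_x - a_i d_y)].  After multiplication by factorials, its
    coefficients satisfy a linear recurrence with simple characteristic roots,
    so that, by Vandermonde, it is a combination of the [(Y + a_i X)^m].  These
    are, up to nonzero constants, the leading forms of the specializations with
    [c_j = 0] for [j < m]: subtracting a suitable combination of those raises
    the order of [u], and [u] is exhausted by induction on [m].

    That the exceptional set has dimension 1 comes from the identity theorem (a
    proper analytic subset of a domain has empty interior), and adding a
    complex line to it makes it non-empty. *)
Require Import Defs.
From HB Require Import structures.
From mathcomp Require Import all_boot all_order all_algebra.
From mathcomp Require Import complex.
From mathcomp Require Import boolp classical_sets functions reals topology.
From mathcomp Require Import normedtype sequences.
From mathcomp Require Import zify ring.

Set Implicit Arguments.
Unset Strict Implicit.
Unset Printing Implicit Defensive.

Import Order.TTheory GRing.Theory Num.Theory.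
Import numFieldNormedType.Exports.

Local Open Scope classical_set_scope.
Local Open Scope complex_scope.
Local Open Scope ring_scope.

(** * The ring of formal power series *)

(** A specialization gives values only to [G^(-l)(f)] with l >= 0, while T produces [G^(s)(f)] with
    s up to n. The missing values come from reading [c] as the series phi(t) = sum_j c_j t^j / j!
    and setting G^(s)(f) = phi^(s)(f), with primitives vanishing at 0 for s < 0. The rule for d
    G^(s)(f) is then the chain rule, so a formal solution becomes a true one; and G^(-l)(f) has
    order at least l, so all the infinite sums converge coefficientwise.

    In the transport step, h_l is chosen to kill the coefficient of G^(n-1-l)(f): there h_(l+1) is
    multiplied by the symbol at df, which is zero, so later choices never spoil earlier ones.

    The analytic part must turn an identity between values (the symbol) into one between Taylor
    series, and must prove the identity theorem. Both are reduced to lines through a point, on which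
    a homogeneous part of degree m is t^m times a constant, so that one-variable arguments apply. *)

Section FpsRing.
Variable K : fieldType.
Implicit Types u v w : fps K.

Definition agree N (p : {poly {poly K}}) u :=
  forall i j, (i < N)%N -> (j < N)%N -> p`_i`_j = u i j.

Definition trunc N u : {poly {poly K}} := \poly_(i < N) \poly_(j < N) u i j.

Lemma agree_trunc N u : agree N (trunc N u) u.
Proof. by move=> i j iN jN; rewrite coef_poly iN coef_poly jN. Qed.

Lemma fpsP u v : (forall i j, u i j = v i j) -> u = v.
Proof. by move=> uv; apply/funext => i; apply/funext => j. Qed.

Lemma agree_inj u v :
  (forall N, exists2 p, agree N p u & agree N p v) -> u = v.
Proof.
move=> uv; apply: fpsP => i j; have [p pu pv] := uv (i + j).+1.
by rewrite -pu -?pv // ltnS ?leq_addr ?leq_addl.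
Qed.

Lemma agreeM N p q u v : agree N p u -> agree N q v ->
  agree N (p * q) (fps_mul u v).
Proof.
move=> pu qv i j iN jN; rewrite coefM coef_sum; apply: eq_bigr => k _.
rewrite coefM; apply: eq_bigr => l _.
by rewrite pu ?qv //; have := ltn_ord k; have := ltn_ord l; lia.
Qed.

Definition fps_add u v : fps K := fun i j => u i j + v i j.
Definition fps_opp u : fps K := fun i j => - u i j.
Definition fps_zero : fps K := fun i j => 0.

Lemma agreeD N p q u v : agree N p u -> agree N q v ->
  agree N (p + q) (fps_add u v).
Proof. by move=> pu qv i j iN jN; rewrite !coefD pu ?qv. Qed.

Lemma agree_one N : agree N 1 (fps_one K).
Proof.
by move=> i j iN jN; rewrite coef1 /fps_one; case: eqP; rewrite ?coef1 ?coef0.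
Qed.

HB.instance Definition _ := gen_eqMixin (fps K).
HB.instance Definition _ := gen_choiceMixin (fps K).

Fact fps_addA : associative fps_add.
Proof. by move=> u v w; apply: fpsP => i j; rewrite /fps_add addrA. Qed.
Fact fps_addC : commutative fps_add.
Proof. by move=> u v; apply: fpsP => i j; rewrite /fps_add addrC. Qed.
Fact fps_add0 : left_id fps_zero fps_add.
Proof. by move=> u; apply: fpsP => i j; rewrite /fps_add add0r. Qed.
Fact fps_addN : left_inverse fps_zero fps_opp fps_add.
Proof. by move=> u; apply: fpsP => i j; rewrite /fps_add addNr. Qed.

HB.instance Definition _ :=
  GRing.isZmodule.Build (fps K) fps_addA fps_addC fps_add0 fps_addN.

Fact fps_mulA : associative (@fps_mul K).
Proof.
move=> u v w; apply: agree_inj => N.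
exists (trunc N u * (trunc N v * trunc N w)).
  by do !apply: agreeM; apply: agree_trunc.
by rewrite mulrA; do !apply: agreeM; apply: agree_trunc.
Qed.

Fact fps_mulC : commutative (@fps_mul K).
Proof.
move=> u v; apply: agree_inj => N; exists (trunc N u * trunc N v).
  by apply: agreeM; apply: agree_trunc.
by rewrite mulrC; apply: agreeM; apply: agree_trunc.
Qed.

Fact fps_mul1 : left_id (fps_one K) (@fps_mul K).
Proof.
move=> u; apply: agree_inj => N; exists (trunc N u); last exact: agree_trunc.
rewrite -[trunc N u]mul1r.
by apply: agreeM; [apply: agree_one | apply: agree_trunc].
Qed.

Fact fps_mulD : left_distributive (@fps_mul K) fps_add.
Proof.
move=> u v w; apply: agree_inj => N.
exists ((trunc N u + trunc N v) * trunc N w).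
  by apply: agreeM (agree_trunc _); apply: agreeD; apply: agree_trunc.
by rewrite mulrDl; apply: agreeD; apply: agreeM; apply: agree_trunc.
Qed.

Fact fps_one_neq0 : fps_one K != fps_zero.
Proof.
apply/eqP => /(congr1 (fun u : fps K => u 0%N 0%N)) /eqP.
by rewrite /fps_one /fps_zero /= oner_eq0.
Qed.

HB.instance Definition _ := GRing.Zmodule_isComNzRing.Build (fps K)
  fps_mulA fps_mulC fps_mul1 fps_mulD fps_one_neq0.

Lemma fps_mulE u v : fps_mul u v = u * v. Proof. by []. Qed.

Lemma fps_expE u m : fps_exp u m = u ^+ m.
Proof. by elim: m => // m IH; rewrite exprS -IH. Qed.

Lemma fps_coefD u v i j : (u + v) i j = u i j + v i j. Proof. by []. Qed.
Lemma fps_coefN u i j : (- u) i j = - u i j. Proof. by []. Qed.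
Lemma fps_coefB u v i j : (u - v) i j = u i j - v i j. Proof. by []. Qed.
Lemma fps_coef0 i j : (0 : fps K) i j = 0. Proof. by []. Qed.

Lemma fps_coef_sum I (r : seq I) (P : pred I) (F : I -> fps K) i j :
  (\sum_(k <- r | P k) F k) i j = \sum_(k <- r | P k) F k i j.
Proof.
by apply: (big_morph (fun u : fps K => u i j)) => // u v.
Qed.

Lemma fps_coefMn u m i j : (u *+ m) i j = u i j *+ m.
Proof. by elim: m => // m IH; rewrite !mulrS -IH. Qed.

Lemma fps_coefM00 u v : (u * v) 0%N 0%N = u 0%N 0%N * v 0%N 0%N.
Proof. by rewrite -fps_mulE /fps_mul !big_ord1. Qed.

Lemma fps_coefX00 u m : (u ^+ m) 0%N 0%N = u 0%N 0%N ^+ m.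
Proof. by elim: m => // m IH; rewrite !exprS fps_coefM00 IH. Qed.

Lemma fps_coef_prod00 I (r : seq I) (P : pred I) (F : I -> fps K) :
  (\prod_(k <- r | P k) F k) 0%N 0%N = \prod_(k <- r | P k) F k 0%N 0%N.
Proof.
by apply: (big_morph (fun u : fps K => u 0%N 0%N)) => // u v; exact: fps_coefM00.
Qed.

Definition fpsC (c : K) : fps K := fps_scale c 1.

Lemma fps_coefC c i j : fpsC c i j = c * ((i == 0%N) && (j == 0%N))%:R.
Proof. by []. Qed.

Lemma fpsCE c u i j : (fpsC c * u) i j = c * u i j.
Proof.
rewrite -fps_mulE /fps_mul (bigD1 ord0) //= (bigD1 ord0) //= !subn0.
rewrite fps_coefC /= mulr1 big1 => [|l l0]; last first.
  by rewrite fps_coefC -[nat_of_ord l == 0%N]/(l == ord0) (negPf l0) mulr0 mul0r.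
rewrite big1 ?addr0 // => k k0; rewrite big1 // => l _.
by rewrite fps_coefC -[nat_of_ord k == 0%N]/(k == ord0) (negPf k0) mulr0 mul0r.
Qed.

Lemma fps_scaleE c u : fps_scale c u = fpsC c * u.
Proof. by apply: fpsP => i j; rewrite fpsCE. Qed.

(** Exchanging the variables turns [fps_dy] into [fps_dx], so the Leibniz rule has to be compared
    with polynomials only once. *)
Definition fps_swap u : fps K := fun i j => u j i.

Lemma fps_swapM u v : fps_swap (u * v) = fps_swap u * fps_swap v.
Proof.
apply: fpsP => i j; rewrite -!fps_mulE /fps_swap /fps_mul exchange_big /=.
by [].
Qed.

(** A derivative reads one coefficient further, which costs one unit of the side of the square. *)
Lemma agree_deriv N p u : agree N.+1 p u -> agree N p^`() (fps_dx u).
Proof.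
by move=> pu i j iN jN; rewrite coef_deriv coefMn pu // ltnS ltnW.
Qed.

Lemma fps_dxD u v : fps_dx (u + v) = fps_dx u + fps_dx v.
Proof. by apply: fpsP => i j; rewrite /fps_dx !fps_coefD mulrnDl. Qed.

Lemma fps_dxM u v : fps_dx (u * v) = fps_dx u * v + u * fps_dx v.
Proof.
have tS N w : agree N (trunc N.+1 w) w.
  by move=> i j iN jN; rewrite agree_trunc // ltnS ltnW.
apply: agree_inj => N; exists (trunc N.+1 u * trunc N.+1 v)^`().
  by apply: agree_deriv; apply: agreeM; apply: agree_trunc.
rewrite derivM; apply: agreeD; apply: agreeM;
  by [apply: agree_deriv; apply: agree_trunc | apply: tS].
Qed.

Lemma fps_dyE u : fps_dy u = fps_swap (fps_dx (fps_swap u)).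
Proof. by []. Qed.

Lemma fps_dyD u v : fps_dy (u + v) = fps_dy u + fps_dy v.
Proof. by apply: fpsP => i j; rewrite /fps_dy !fps_coefD mulrnDl. Qed.

Lemma fps_dyM u v : fps_dy (u * v) = fps_dy u * v + u * fps_dy v.
Proof.
rewrite fps_dyE fps_swapM fps_dxM.
transitivity (fps_swap (fps_dx (fps_swap u) * fps_swap v) +
              fps_swap (fps_swap u * fps_dx (fps_swap v))); first by [].
by rewrite !fps_swapM.
Qed.

End FpsRing.

(** * Order of vanishing and infinite sums *)

(** Dependent choice for a sequence whose l-th condition involves only the entries up to l. It
    builds the constants of the specializations, the X-coefficients of a solution of a transport
    equation, and the [h l]. *)
Lemma recursive_choice (T : Type) (x0 : T) (P : nat -> (nat -> T) -> Prop) :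
  (forall l h h', (forall k, (k <= l)%N -> h k = h' k) -> P l h -> P l h') ->
  (forall l h, (forall k, (k < l)%N -> P k h) ->
     exists x, P l (fun k => if k == l then x else h k)) ->
  exists h, forall l, P l h.
Proof.
move=> loc step.
pose Q l h x := (forall k, (k < l)%N -> P k h) ->
  P l (fun k => if k == l then x else h k).
have ex lh : exists x, Q lh.1 lh.2 x.
  have [Pk|nPk] := pselect (forall k, (k < lh.1)%N -> P k lh.2).
    by have [x Px] := step _ _ Pk; exists x.
  by exists x0 => Pk; have := nPk Pk.
have [F FP] := choice ex.
(* [H l] is the sequence after l stages; stage k touches only entry k, so the diagonal agrees with
   [H l] below l. *)
pose H := fix H l := if l is l'.+1 then
   (fun k => if k == l' then F (l', H l') else H l' k) else fun=> x0.
have HS l k : (k < l)%N -> H l k = H k.+1 k.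
  elim: l => // l IH; rewrite ltnS leq_eqVlt => /predU1P[->//|kl].
  by rewrite -IH //=; case: eqP kl => // ->; rewrite ltnn.
have PH l : forall k, (k < l)%N -> P k (H l).
  elim: l => // l IH k; rewrite ltnS leq_eqVlt => /predU1P[->|kl].
    exact: (FP (l, H l) IH).
  apply: loc (IH _ kl) => m mk /=.
  by case: eqP => // ml; move: mk kl; rewrite ml; lia.
exists (fun l => H l.+1 l) => l; apply: loc (PH l.+1 l _) => // k kl.
by rewrite HS.
Qed.

Section Order.
Variable K : fieldType.
Implicit Types u v : fps K.

Definition ordge m u := forall i j, (i + j < m)%N -> u i j = 0.

Lemma ordgeW m m' u : (m' <= m)%N -> ordge m u -> ordge m' u.
Proof. by move=> mm um i j ij; apply: um; apply: leq_trans mm. Qed.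

Lemma ordgeD m u v : ordge m u -> ordge m v -> ordge m (u + v).
Proof. by move=> um vm i j ij; rewrite fps_coefD um // vm // addr0. Qed.

Lemma ordgeN m u : ordge m u -> ordge m (- u).
Proof. by move=> um i j ij; rewrite fps_coefN um // oppr0. Qed.

Lemma ordgeB m u v : ordge m u -> ordge m v -> ordge m (u - v).
Proof. by move=> um vm; apply: ordgeD um (ordgeN vm). Qed.

Lemma ordge_sum m I (r : seq I) (P : pred I) (F : I -> fps K) :
  (forall k, P k -> ordge m (F k)) -> ordge m (\sum_(k <- r | P k) F k).
Proof.
by move=> Fm; apply: (big_ind (ordge m)) => //; apply: ordgeD.
Qed.

Lemma ordgeM a b u v : ordge a u -> ordge b v -> ordge (a + b) (u * v).
Proof.
move=> ua vb i j ij; rewrite -fps_mulE /fps_mul.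
apply: big1 => k _; apply: big1 => l _.
have [kl|kl] := ltnP (k + l) a; first by rewrite ua // mul0r.
rewrite vb ?mulr0 //; have := ltn_ord k; have := ltn_ord l; lia.
Qed.

Lemma ordgeMl m u v : ordge m v -> ordge m (u * v).
Proof. exact: (@ordgeM 0). Qed.

Lemma ordge1X u m : ordge 1 u -> ordge m (u ^+ m).
Proof.
move=> u1; elim: m => // m IH; rewrite exprS -add1n; exact: ordgeM.
Qed.

Lemma ordge1P u : u 0%N 0%N = 0 -> ordge 1 u.
Proof. by move=> u0 [|i] [|j]. Qed.

Lemma ordge_eq u v : (forall m, ordge m (u - v)) -> u = v.
Proof.
move=> uv; apply: fpsP => i j; apply/eqP; rewrite -subr_eq0 -fps_coefB.
by rewrite (uv (i + j).+1).
Qed.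

Lemma ordge_dx m u : ordge m.+1 u -> ordge m (fps_dx u).
Proof. by move=> um i j ij; rewrite /fps_dx um ?mul0rn. Qed.

Lemma ordge_dy m u : ordge m.+1 u -> ordge m (fps_dy u).
Proof. by move=> um i j ij; rewrite /fps_dy um ?mul0rn ?addnS. Qed.

(** In total degree m, every other product in the convolution involves a coefficient of [u] of
    degree less than m. *)
Lemma lead_mul m u v i j : ordge m u -> (i + j = m)%N ->
  (u * v) i j = u i j * v 0%N 0%N.
Proof.
move=> um ijm; rewrite -fps_mulE /fps_mul.
rewrite (bigD1 ord_max) //= (bigD1 ord_max) //= !subnn.
rewrite [X in _ + X + _]big1 ?addr0 => [|l lj].
  rewrite big1 ?addr0 // => k ki; apply: big1 => l _; rewrite um ?mul0r //.
  have : nat_of_ord k != i := ki.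
  by have := ltn_ord k; have := ltn_ord l; lia.
rewrite um ?mul0r //.
have : nat_of_ord l != j := lj.
by have := ltn_ord l; lia.
Qed.

(** Convergence with one rank for all coefficients of total degree less than d. There are finitely
    many of them, so this is the same as [fps_sums_to], but it combines well with [ordge]. *)
Definition sums (w : nat -> fps K) u :=
  forall d, exists N0, forall N, (N0 <= N)%N -> ordge d (u - \sum_(k < N) w k).

Lemma sumsP w u : fps_sums_to w u <-> sums w u.
Proof.
split=> [wu d|wu i j].
  have near_ij (i : 'I_d) (j : 'I_d) :
      \forall N \near \oo, \sum_(k < N) w k i j = u i j by apply: wu.
  have : \forall N \near \oo, forall i j : 'I_d, \sum_(k < N) w k i j = u i j.
    by apply: filter_forall => i; apply: filter_forall => j.
  move=> [N0 _ H]; exists N0 => N NN0 i j ijd.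
  have id : (i < d)%N by lia.
  have jd : (j < d)%N by lia.
  rewrite fps_coefB fps_coef_sum.
  by have /= := H N NN0 (Ordinal id) (Ordinal jd) => ->; rewrite subrr.
have [N0 H] := wu (i + j).+1; exists N0 => // N /= NN0.
have := H N NN0 i j (ltnSn _); rewrite fps_coefB fps_coef_sum => /eqP.
by rewrite subr_eq0 eq_sym => /eqP.
Qed.

Lemma sums_unique w u v : sums w u -> sums w v -> u = v.
Proof.
move=> wu wv; apply: ordge_eq => d.
have [N1 H1] := wu d; have [N2 H2] := wv d.
rewrite -[u](subrK (\sum_(k < maxn N1 N2) w k)) -addrA -[_ - v]opprB.
by apply: ordgeB; [apply: H1 | apply: H2]; rewrite ?leq_maxl ?leq_maxr.
Qed.

Lemma eq_sums w w' u : w =1 w' -> sums w u -> sums w' u.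
Proof. by move=> /funext ->. Qed.

Lemma sumsD w w' u u' : sums w u -> sums w' u' ->
  sums (fun k => w k + w' k) (u + u').
Proof.
move=> wu wu' d; have [N1 H1] := wu d; have [N2 H2] := wu' d.
exists (maxn N1 N2) => N; rewrite geq_max => /andP[N1N N2N].
by rewrite big_split /= opprD addrACA; apply: ordgeD; [apply: H1 | apply: H2].
Qed.

Lemma sumsM c w u : sums w u -> sums (fun k => c * w k) (c * u).
Proof.
move=> wu d; have [N0 H] := wu d; exists N0 => N NN0.
by rewrite -mulr_sumr -mulrBr; apply: ordgeMl; apply: H.
Qed.

Lemma sums0 : sums (fun=> 0) 0.
Proof. by move=> d; exists 0%N => N _; rewrite big1 // subr0. Qed.

Lemma sums_derivation (d : fps K -> fps K) w u :
  (forall u v, d (u + v) = d u + d v) ->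
  (forall m u, ordge m.+1 u -> ordge m (d u)) ->
  sums w u -> sums (fun k => d (w k)) (d u).
Proof.
move=> dD dord wu m; have [N0 H] := wu m.+1; exists N0 => N NN0.
have d0 : d 0 = 0 by apply: (@addrI _ (d 0)); rewrite -dD !addr0.
have dN v : d (- v) = - d v.
  by apply/eqP; rewrite -addr_eq0 -dD addNr d0.
rewrite -(big_morph d dD d0) -dN -dD; exact/dord/H.
Qed.

Lemma sums_shift w u : sums w u -> sums (fun k => if k is k'.+1 then w k' else 0) u.
Proof.
move=> wu d; have [N0 H] := wu d; exists N0.+1 => -[//|N] NN0.
by rewrite big_ord_recl add0r; apply: H.
Qed.

Lemma sums_unshift w u : w 0%N = 0 -> sums w u -> sums (fun k => w k.+1) u.
Proof.
move=> w0 wu d; have [N0 H] := wu d; exists N0 => N NN0.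
by have := H N.+1 (leqW NN0); rewrite big_ord_recl w0 add0r.
Qed.

Lemma sums_ord m w u : (forall k, ordge m (w k)) -> sums w u -> ordge m u.
Proof.
move=> wm wu; have [N0 H] := wu m.
rewrite -[u](subrK (\sum_(k < N0) w k)); apply: ordgeD; first exact: H.
by apply: ordge_sum => k _.
Qed.

(** The cut at [(i + j).+1] is meaningful when [w k] has order at least k: later terms do not reach
    degree i + j. *)
Definition fsum (w : nat -> fps K) : fps K :=
  fun i j => \sum_(k < (i + j).+1) w k i j.

Lemma fsumP w : (forall k, ordge k (w k)) -> sums w (fsum w).
Proof.
move=> wk; apply/sumsP => i j; exists (i + j).+1 => // N /= ijN.
rewrite /fsum -(big_mkord xpredT (fun k => w k i j)).
rewrite -(big_mkord xpredT (fun k => w k i j)) (@big_cat_nat _ _ _ (i + j).+1) //=.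
rewrite [X in _ + X]big_nat [X in _ + X]big1 ?addr0 // => k /andP[ijk _].
exact: wk.
Qed.

End Order.

(** * Specializations are solutions *)

Section Specialization.
Variable K : numFieldType.
Implicit Types (u v : fps K) (g : gser K).

Lemma sums_unshiftn l w u : (forall k, (k < l)%N -> w k = 0) ->
  @sums K w u -> sums (fun k => w (k + l)%N) u.
Proof.
elim: l w => [|l IH] w w0 wu; first by apply: eq_sums wu => k; rewrite addn0.
apply: eq_sums (IH (fun k => w k.+1) _ _) => [k|k kl|]; first by rewrite addnS.
  exact: w0.
exact: sums_unshift (w0 _ _) wu.
Qed.

(** Delaying the [p] terms by one index removes only the last of them from a partial sum, and its
    order tends to infinity. *)
Lemma sums_stagger c p q u : (forall k, ordge (k - c) (p k)) ->
  @sums K (fun k => p k + q k) u ->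
  sums (fun k => (if k is k'.+1 then p k' else 0) + q k) u.
Proof.
move=> pc pqu d; have [N0 H] := pqu d; exists (maxn N0 (c + d).+1) => N.
rewrite geq_max => /andP[N0N]; case: N N0N => // N N0N; rewrite ltnS => cdN.
have := H _ N0N; rewrite !big_split /= => Hu.
rewrite big_ord_recl add0r.
have -> : u - (\sum_(i < N) p i + \sum_(i < N.+1) q i) =
    u - (\sum_(i < N.+1) p i + \sum_(i < N.+1) q i) + p N.
  by rewrite [X in _ = u - (X + _) + _]big_ord_recr /=; ring.
by apply: ordgeD Hu _; apply: ordgeW (pc N); lia.
Qed.

(** The last field is continuity for the (X, Y)-adic topology, which allows infinite sums to be
    differentiated termwise. *)
Record derivation (d : fps K -> fps K) : Prop := Derivation {
  derivationD : forall u v, d (u + v) = d u + d v;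
  derivationM : forall u v, d (u * v) = d u * v + u * d v;
  derivationC : forall c u, d (fpsC c * u) = fpsC c * d u;
  derivation_ordge : forall m u, ordge m.+1 u -> ordge m (d u) }.

Lemma derivation_dx : derivation (@fps_dx K).
Proof.
split; [exact: fps_dxD|exact: fps_dxM| |exact: ordge_dx].
by move=> c u; apply: fpsP => i j; rewrite /fps_dx !fpsCE mulrnAr.
Qed.

Lemma derivation_dy : derivation (@fps_dy K).
Proof.
split; [exact: fps_dyD|exact: fps_dyM| |exact: ordge_dy].
by move=> c u; apply: fpsP => i j; rewrite /fps_dy !fpsCE mulrnAr.
Qed.

Section Der.
Variables (d : fps K -> fps K) (dP : derivation d).

Lemma derivation0 : d 0 = 0.
Proof. by apply: (@addrI _ (d 0)); rewrite -(derivationD dP) !addr0. Qed.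

Lemma derivation1 : d 1 = 0.
Proof.
have := derivationM dP 1 1; rewrite !mulr1 mul1r => d1.
by apply: (@addrI _ (d 1)); rewrite -d1 addr0.
Qed.

Lemma derivationX u m : d (u ^+ m.+1) = d u * u ^+ m *+ m.+1.
Proof.
elim: m => [|m IH]; first by rewrite expr0 mulr1.
rewrite [in LHS]exprS (derivationM dP) IH [in RHS]mulrS mulrnAr mulrCA.
by rewrite -exprS.
Qed.
End Der.

Section Subst.
Variables (f : fps K) (f1 : ordge 1 f).

(** Substitution of [f] in the exponential generating series of [e]. With this normalization,
    differentiating the outer series is a shift of [e]. *)
Definition subst (e : nat -> K) : fps K :=
  fsum (fun m => fpsC (e m / m`!%:R) * f ^+ m).

Lemma substP e : sums (fun m => fpsC (e m / m`!%:R) * f ^+ m) (subst e).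
Proof. by apply: fsumP => k; apply: ordgeMl; apply: ordge1X. Qed.

Lemma subst_derivation d e : derivation d ->
  d (subst e) = d f * subst (fun m => e m.+1).
Proof.
move=> dP; have := sums_derivation (derivationD dP) (derivation_ordge dP) (substP e).
move/sums_unshift => /(_ _) dsub; apply: sums_unique (dsub _) _.
  by rewrite (derivationC dP) (derivation1 dP) mulr0.
apply: eq_sums (sumsM (d f) (substP _)) => m.
rewrite (derivationC dP) (derivationX dP) mulrCA.
apply: fpsP => i j; rewrite !fpsCE fps_coefMn -[in RHS]mulr_natr.
rewrite factS natrM; field.
by rewrite !pnatr_eq0 -lt0n fact_gt0 addrC natr1 pnatr_eq0.
Qed.

Lemma subst_ordge m e : (forall k, (k < m)%N -> e k = 0) -> ordge m (subst e).
Proof.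
move=> e0; apply: sums_ord (substP e) => k.
have [km|mk] := ltnP k m; last exact/ordgeMl/(ordgeW mk)/ordge1X.
by move=> i j _; rewrite fpsCE e0 // !mul0r.
Qed.

Definition int_extend (c : nat -> K) (s : int) : K :=
  if 0 <= s then c `|s|%N else 0.

(* The value of [G^(s)(f)] for all integers [s]: with [phi t] the sum of the
   [c_j t^j / j!], it is [phi^(s)(f)], where primitives vanish at [0]. *)
Definition Gval (c : nat -> K) (s : int) : fps K :=
  subst (fun m => int_extend c (m%:Z + s)).

Lemma Gval_derivation d c s : derivation d ->
  d (Gval c s) = d f * Gval c (s + 1).
Proof.
move=> dP; rewrite /Gval (subst_derivation _ dP); congr (_ * subst _).
by apply/funext => m; congr int_extend; lia.
Qed.

Lemma Gval_ordge l c s : l%:Z <= - s -> ordge l (Gval c s).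
Proof.
move=> ls; apply: subst_ordge => k kl; rewrite /int_extend.
by case: ifP => //; lia.
Qed.

Lemma Gval_sums c l : sums (fun j =>
  fps_scale (c j / ((j + l)`!)%:R) (fps_exp f (j + l))) (Gval c (- l%:Z)).
Proof.
apply: eq_sums (sums_unshiftn (l := l) _ (substP _)) => [j|k kl].
  rewrite fps_scaleE fps_expE; congr (fpsC (_ / _) * _).
  by rewrite /int_extend ifT; [congr c|]; lia.
rewrite /int_extend ifF; last by lia.
by apply: fpsP => i j; rewrite fpsCE !mul0r.
Qed.

Definition spec h c : fps K := fsum (fun l => h l * Gval c (- l%:Z)).

Lemma specP h c : sums (fun l => h l * Gval c (- l%:Z)) (spec h c).
Proof. by apply: fsumP => l; apply/ordgeMl/Gval_ordge; rewrite opprK. Qed.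

(** Adic sums are unique, so [c] determines both the values of the symbols and the final sum. *)
Lemma specializationP h u : specialization f h u <-> exists c, u = spec h c.
Proof.
split=> [[c [G [GP /sumsP hGu]]]|[c ->]].
  exists c; apply: sums_unique hGu _; apply: eq_sums (specP h c) => l.
  by congr (_ * _); apply: sums_unique (Gval_sums c l) _; apply/sumsP.
exists c, (fun l => Gval c (- l%:Z)); split; last exact/sumsP/specP.
by move=> l; apply/sumsP/Gval_sums.
Qed.

(* [u] is the value of the formal series [g], which has no term above
   [G^(n)(f)], under [G^(s)(f) := Gval c s]. *)
Definition evaluates c (n : nat) g u :=
  (forall s, n%:Z < s -> g s = 0) /\
  sums (fun k => g (n%:Z - k%:Z) * Gval c (n%:Z - k%:Z)) u.

(** The formal derivation on symbols and the actual one on values correspond, because [Gval] obeys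
    the same rule as the symbols. *)
Lemma evaluates_der d c n g u : derivation d -> evaluates c n g u ->
  evaluates c n.+1 (gser_der d f g) (d u).
Proof.
move=> dP [g0 gu].
have derE s : gser_der d f g s = d (g s) + d f * g (s - 1) by [].
split=> [s ns|].
  by rewrite derE !g0 ?(derivation0 dP) ?mulr0 ?addr0 //; lia.
have := sums_derivation (derivationD dP) (derivation_ordge dP) gu.
move/(eq_sums (fun k => derivationM dP _ _)) => dgu.
(* By Leibniz, the k-th term gives one part at G^(n-k) and one at G^(n-k+1). With n + 1 as the new
   top, the second is already at place k and the first belongs at place k + 1. Since G^(n-k) has
   order at least k - n, the delay is harmless. *)
apply: eq_sums (sums_stagger (c := n) _ dgu) => [k|k].
  rewrite derE mulrDl (Gval_derivation _ _ dP).
  have -> : n.+1%:Z - k%:Z = n%:Z - k%:Z + 1 by lia.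
  rewrite addrK; congr (_ + _); last by ring.
  case: k => [|k]; last first.
    by have -> : n%:Z - k.+1%:Z + 1 = n%:Z - k%:Z by lia.
  by rewrite g0 ?(derivation0 dP) ?mul0r //; lia.
have [kn|nk] := leqP k n; first by move: kn; rewrite -subn_eq0 => /eqP ->.
by apply/ordgeMl/Gval_ordge; lia.
Qed.

Lemma evaluates_iter d c n g u i : derivation d -> evaluates c n g u ->
  evaluates c (i + n) (iter i (gser_der d f) g) (iter i d u).
Proof. by move=> dP gu; elim: i => // i IH; apply: evaluates_der. Qed.

Lemma evaluatesM c n g u v : evaluates c n g u ->
  evaluates c n (fun s => v * g s) (v * u).
Proof.
move=> [g0 gu]; split=> [s ns|]; first by rewrite g0 ?mulr0.
by apply: eq_sums (sumsM v gu) => k; rewrite mulrA.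
Qed.

Lemma evaluatesD c n g g' u u' : evaluates c n g u -> evaluates c n g' u' ->
  evaluates c n (fun s => g s + g' s) (u + u').
Proof.
move=> [g0 gu] [g0' gu']; split=> [s ns|]; first by rewrite g0 ?g0' ?addr0.
by apply: eq_sums (sumsD gu gu') => k; rewrite mulrDl.
Qed.

Lemma evaluates0 c n : evaluates c n (fun=> 0) 0.
Proof. by split=> //; apply: eq_sums (@sums0 K) => k; rewrite mul0r. Qed.

Lemma evaluates_sum c n (I : Type) (r : seq I) (P : pred I) (F : I -> gser K) U :
  (forall k, P k -> evaluates c n (F k) (U k)) ->
  evaluates c n (fun s => \sum_(k <- r | P k) F k s) (\sum_(k <- r | P k) U k).
Proof.
move=> FU; elim: r => [|k r IH].
  rewrite big_nil; have -> : (fun s => \sum_(k <- [::] | P k) F k s) = fun=> 0.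
    by apply/funext => s; rewrite big_nil.
  exact: evaluates0.
have -> : (fun s => \sum_(k <- k :: r | P k) F k s) = fun s =>
    (if P k then F k s else 0) + \sum_(k <- r | P k) F k s.
  by apply/funext => s; rewrite big_cons; case: ifP; rewrite ?add0r.
have -> : \sum_(k <- k :: r | P k) U k =
    (if P k then U k else 0) + \sum_(k <- r | P k) U k.
  by rewrite big_cons; case: ifP; rewrite ?add0r.
apply: evaluatesD IH; case: ifP => [/FU//|_]; exact: evaluates0.
Qed.

Lemma evaluatesS c n g u : evaluates c n g u -> evaluates c n.+1 g u.
Proof.
move=> [g0 gu]; split=> [s ns|]; first by apply: g0; lia.
apply: eq_sums (sums_shift gu) => -[|k]; first by rewrite g0 ?mul0r //; lia.
by congr (g _ * Gval c _); lia.
Qed.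

Lemma evaluatesW c m n g u : (m <= n)%N -> evaluates c m g u -> evaluates c n g u.
Proof.
move=> /subnK <- gu; elim: (n - m)%N => // k IH; exact: evaluatesS.
Qed.

Lemma fps_opE n b u : fps_op n b u =
  \sum_(i < n.+1) \sum_(j < n.+1 | (i + j <= n)%N)
    b i j * iter i (@fps_dx K) (iter j (@fps_dy K) u).
Proof.
apply: fpsP => k l; rewrite fps_coef_sum; apply: eq_bigr => i _.
by rewrite fps_coef_sum.
Qed.

Lemma gser_opE n b g s : gser_op n b f g s =
  \sum_(i < n.+1) \sum_(j < n.+1 | (i + j <= n)%N)
    b i j * iter i (gser_der (@fps_dx K) f) (iter j (gser_der (@fps_dy K) f) g) s.
Proof.
apply: fpsP => k l; rewrite fps_coef_sum; apply: eq_bigr => i _.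
by rewrite fps_coef_sum.
Qed.

Lemma evaluates_op c n b g u : evaluates c 0 g u ->
  evaluates c n (gser_op n b f g) (fps_op n b u).
Proof.
move=> gu; rewrite fps_opE; have -> : gser_op n b f g = fun s => \sum_(i < n.+1)
    \sum_(j < n.+1 | (i + j <= n)%N)
    b i j * iter i (gser_der (@fps_dx K) f) (iter j (gser_der (@fps_dy K) f) g) s.
  by apply/funext => s; exact: gser_opE.
apply: evaluates_sum => i _; apply: evaluates_sum => j ij; apply: evaluatesM.
(* The term of index (i, j) ends at G^(i+j); padding with zeros gives all terms the common top n. *)
apply: (evaluatesW ij); rewrite -[(i + j)%N]addn0 -addnA.
by do !apply: evaluates_iter => //; [exact: derivation_dx|exact: derivation_dy].
Qed.

Lemma spec_evaluates h c : evaluates c 0 (frac_series h) (spec h c).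
Proof.
split=> [s s0|]; first by rewrite /frac_series leNgt s0.
apply: eq_sums (specP h c) => k; rewrite sub0r; congr (_ * _).
by rewrite /frac_series ifT; [congr h; lia | lia].
Qed.

(** T commutes with evaluation, and the formal series obtained by applying T has all its
    coefficients zero. *)
Lemma spec_solution n b h c : frac_solution n b f h ->
  fps_op n b (spec h c) = 0.
Proof.
move=> hP; have [_] := evaluates_op n b (spec_evaluates h c).
move/sums_unique; apply; apply: eq_sums (@sums0 K) => k.
by rewrite (_ : gser_op _ _ _ _ _ = 0) ?mul0r //; apply: fpsP.
Qed.

End Subst.
End Specialization.

(** * Leading forms *)

Section LeadingForms.
Variable K : numFieldType.
Implicit Types (u v f : fps K).

(** The first n values are matched by inverting a Vandermonde matrix. Since [e n = 1], the
    recurrence then forces all values up to m. *)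
Lemma recurrence_solution n (a : 'I_n -> K) (e p : nat -> K) m :
  injective a -> e n = 1 ->
  (forall k, \sum_(i < n.+1) e i * a k ^+ i = 0) ->
  (forall k, (k + n <= m)%N -> \sum_(i < n.+1) e i * p (k + i)%N = 0) ->
  exists g : 'I_n -> K,
    forall k, (k <= m)%N -> p k = \sum_(j < n) g j * a j ^+ k.
Proof.
move=> a_inj en1 ea0 ep0; pose V := Vandermonde n (\row_j a j).
have Vunit : V^T \in unitmx.
  rewrite unitmx_tr unitmxE det_Vandermonde unitfE.
  apply/prodf_neq0 => i _; apply/prodf_neq0 => j ij.
  by rewrite !mxE subr_eq0; apply: contraTneq ij => /a_inj ->; rewrite ltnn.
(* If m < n - 1, the values of [p] between m and n also enter here; any values there give a valid
   [g]. *)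
pose g := (\row_(k < n) p k) *m invmx V^T.
have gE (k : 'I_n) : p k = \sum_j g 0 j * a j ^+ k.
  have := congr1 (fun A : 'rV_n => A 0 k) (mulmxKV Vunit (\row_(k < n) p k)).
  rewrite -/g !mxE => <-; apply: eq_bigr => j _.
  by rewrite /V !mxE.
exists (g 0) => k; have [r] := ubnP k; elim: r k => // r IH k; rewrite ltnS => kr km.
have [kn|nk] := ltnP k n; first exact: (gE (Ordinal kn)).
(* The relation starting at k - n expresses the value at k by the n preceding ones, so two sequences
   satisfying it and agreeing on those agree at k. *)
have shift x : (forall i : 'I_n, x (k - n + i)%N = p (k - n + i)%N) ->
    \sum_(i < n.+1) e i * x (k - n + i)%N = 0 -> x k = p k.
  have := ep0 (k - n)%N; rewrite subnK // => /(_ km).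
  rewrite !big_ord_recr /= en1 !mul1r subnK // => pE xp.
  rewrite (eq_bigr (fun i : 'I_n => e i * p (k - n + i)%N)); last first.
    by move=> i _; rewrite xp.
  by rewrite -[RHS]pE => /addrI.
symmetry; apply: (shift (fun k => \sum_j g 0 j * a j ^+ k)) => [i|].
  by symmetry; apply: IH; have := ltn_ord i; lia.
under eq_bigr do rewrite mulr_sumr; rewrite exchange_big big1 //= => j _.
rewrite (eq_bigr (fun i : 'I_n.+1 =>
  g 0 j * a j ^+ (k - n) * (e i * a j ^+ i))) => [|i _].
  by rewrite -mulr_sumr ea0 mulr0.
by rewrite exprD; ring.
Qed.

(** Multiplied by factorials, coefficients are merely shifted by differentiation; this is what makes
    the recurrence below have constant coefficients. *)
Lemma coef_iter_dx i u k l :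
  k`!%:R * iter i (@fps_dx K) u k l = (k + i)`!%:R * u (k + i)%N l.
Proof.
elim: i k => [|i IH] k; first by rewrite addn0.
transitivity (k.+1`!%:R * iter i (@fps_dx K) u k.+1 l).
  rewrite iterS {1}/fps_dx factS natrM -[_ *+ k.+1]mulr_natr; ring.
by rewrite IH addSnnS.
Qed.

Lemma coef_iter_dy j u k l :
  l`!%:R * iter j (@fps_dy K) u k l = (l + j)`!%:R * u k (l + j)%N.
Proof.
elim: j l => [|j IH] l; first by rewrite addn0.
transitivity (l.+1`!%:R * iter j (@fps_dy K) u k l.+1).
  rewrite iterS {1}/fps_dy factS natrM -[_ *+ l.+1]mulr_natr; ring.
by rewrite IH addSnnS.
Qed.

Lemma ordge_iter (d : fps K -> fps K) i m u : derivation d ->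
  ordge m u -> ordge (m - i) (iter i d u).
Proof.
move=> dP um; elim: i => [|i IH]; first by rewrite subn0.
rewrite iterS; have [im|mi] := ltnP i m.
  by apply: (derivation_ordge dP); rewrite -subSn // subSS.
by have -> : (m - i.+1 = 0)%N by lia.
Qed.

(** In degree m - n, only the terms of T of order exactly n are visible, and only through the
    constant terms of their coefficients. *)
Lemma lead_op n (B : nat -> nat -> fps K) m u k : ordge m u -> (k + n <= m)%N ->
  k`!%:R * (m - n - k)`!%:R * fps_op n B u k (m - n - k)%N =
  \sum_(i < n.+1) B i (n - i)%N 0%N 0%N *
     ((k + i)`!%:R * (m - (k + i))`!%:R * u (k + i)%N (m - (k + i))%N).
Proof.
move=> um knm; set l := (m - n - k)%N.
rewrite fps_opE fps_coef_sum mulr_sumr; apply: eq_bigr => i _.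
have wm j : ordge (m - j - i) (iter i (@fps_dx K) (iter j (@fps_dy K) u)).
  by do !apply: ordge_iter => //; [exact: derivation_dx|exact: derivation_dy].
have ilen : (i <= n)%N by rewrite -ltnS.
rewrite fps_coef_sum (bigD1 (inord (n - i))) /=; last first.
  by rewrite inordK; lia.
rewrite big1 ?addr0 => [|j /andP[ijn jN]]; last first.
  apply: (ordgeMl _ (wm j)).
  have : nat_of_ord j != (n - i)%N.
    by apply: contraNneq jN => jE; apply/eqP/val_inj; rewrite /= inordK; lia.
  by rewrite /l; lia.
rewrite inordK; last by lia.
rewrite [B _ _ * _]mulrC (lead_mul _ (wm _)); last by rewrite /l; lia.
rewrite mulrA [RHS]mulrC; congr (_ * _).
rewrite mulrAC mulrC coef_iter_dx mulrCA coef_iter_dy mulrA.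
by have -> : (l + (n - i) = m - (k + i))%N by rewrite /l; lia.
Qed.

(** The leading form of [f ^+ m] is the m-th power of the linear part of [f]. The induction reads
    off the coefficients of d(f^(m+1)) = (m+1) f^m df instead of expanding a binomial. *)
Lemma coef_exp_lead f m i j : ordge 1 f -> (i + j = m)%N ->
  i`!%:R * j`!%:R * (f ^+ m) i j =
  m`!%:R * f 1%N 0%N ^+ i * f 0%N 1%N ^+ j.
Proof.
move=> f1; elim: m i j => [|m IH] i j ijm.
  have [-> ->] : i = 0%N /\ j = 0%N by lia.
  by rewrite !mulr1.
case: i ijm => [|i] ijm.
  case: j ijm => // j ijm.
  have jm : (0 + j = m)%N by lia.
  have := congr1 (fun u : fps K => u 0%N j) (derivationX (derivation_dy K) f m).
  rewrite fps_coefMn [_ * f ^+ m]mulrC (lead_mul _ (ordge1X (m := m) f1)) //.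
  rewrite /fps_dy -[LHS]mulr_natr -[RHS]mulr_natr mulr1n => E; have := IH 0%N j jm.
  rewrite fact0 !factS !natrM mul1r => E'.
  transitivity (j`!%:R * ((f ^+ m.+1) 0%N j.+1 * j.+1%:R)); first by ring.
  by rewrite E exprS; ring: E'.
have im : (i + j = m)%N by lia.
have := congr1 (fun u : fps K => u i j) (derivationX (derivation_dx K) f m).
rewrite fps_coefMn [_ * f ^+ m]mulrC (lead_mul _ (ordge1X (m := m) f1)) //.
rewrite /fps_dx -[LHS]mulr_natr -[RHS]mulr_natr mulr1n => E; have := IH i j im.
rewrite !factS !natrM => E'.
transitivity (i`!%:R * j`!%:R * ((f ^+ m.+1) i.+1 j * i.+1%:R)); first by ring.
by rewrite E exprS; ring: E'.
Qed.

Lemma Gval_sub f c c' s : ordge 1 f ->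
  Gval f (fun k => c k - c' k) s = Gval f c s - Gval f c' s.
Proof.
move=> f1; have := sumsD (substP f1 (fun m => int_extend c (m%:Z + s)))
  (sumsM (-1) (substP f1 (fun m => int_extend c' (m%:Z + s)))).
rewrite mulN1r => /(sums_unique _) E; apply: E.
apply: eq_sums (substP f1 _) => m; rewrite mulN1r -mulrBl; congr (_ * _).
apply: fpsP => i j; rewrite fps_coefB !fps_coefC -!mulrBl /int_extend.
by case: ifP; rewrite // subr0.
Qed.

Lemma spec_sub f h c c' : ordge 1 f ->
  spec f h (fun k => c k - c' k) = spec f h c - spec f h c'.
Proof.
move=> f1; have := sumsD (specP f1 h c) (sumsM (-1) (specP f1 h c')).
rewrite mulN1r => /(sums_unique _) E; apply: E.
by apply: eq_sums (specP f1 _ _) => l; rewrite mulN1r Gval_sub // mulrBr.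
Qed.

Lemma spec_ordge f h c m : ordge 1 f -> (forall k, (k < m)%N -> c k = 0) ->
  ordge m (spec f h c).
Proof.
move=> f1 c0; apply: sums_ord (specP f1 h c) => l; apply: ordgeMl.
apply: subst_ordge => // k km; rewrite /int_extend.
by case: ifP => // kl; apply: c0; lia.
Qed.

(** Here G^(-l)(f) starts in degree m + l, so degree m sees only l = 0; in G^(0)(f) it sees only the
    term c_m f^m / m!. *)
Lemma spec_lead f h c m i j : ordge 1 f -> (forall k, (k < m)%N -> c k = 0) ->
  (i + j = m)%N ->
  i`!%:R * j`!%:R * spec f h c i j =
  c m * h 0%N 0%N 0%N * f 1%N 0%N ^+ i * f 0%N 1%N ^+ j.
Proof.
move=> f1 c0 ijm.
have tail : ordge m.+1 (spec f h c - h 0%N * Gval f c 0).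
  have : sums (fun l => h l * Gval f c (- l%:Z) -
      (if l == 0%N then h 0%N * Gval f c 0 else 0))
      (spec f h c - h 0%N * Gval f c 0).
    have h0sum : sums (fun l => if l == 0%N then h 0%N * Gval f c 0 else 0)
        (h 0%N * Gval f c 0).
      move=> d; exists 1%N => -[//|N] _.
      by rewrite big_ord_recl /= big1 // addr0 subrr.
    have := sumsD (specP f1 h c) (sumsM (-1) h0sum); rewrite mulN1r.
    by apply: eq_sums => l; rewrite mulN1r.
  apply: sums_ord => -[|l] /=; first by rewrite oppr0 subrr.
  rewrite subr0; apply/ordgeMl/subst_ordge => // k; rewrite ltnS => km.
  by rewrite /int_extend; case: ifP => // kl; apply: c0; lia.
have := tail i j; rewrite ijm ltnSn => /(_ isT) /eqP.
rewrite fps_coefB subr_eq0 => /eqP ->.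
have Gm : ordge m (Gval f c 0).
  by apply: subst_ordge => // k km; rewrite /int_extend addr0 /= c0.
rewrite (mulrC (h 0%N)) (lead_mul _ Gm) //.
have Gtail : ordge m.+1 (Gval f c 0 - fpsC (c m / m`!%:R) * f ^+ m).
  have : sums (fun l => fpsC (int_extend c (l%:Z + 0) / l`!%:R) * f ^+ l -
      (if l == m then fpsC (c m / m`!%:R) * f ^+ m else 0))
      (Gval f c 0 - fpsC (c m / m`!%:R) * f ^+ m).
    have msum : sums (fun l => if l == m then fpsC (c m / m`!%:R) * f ^+ m else 0)
        (fpsC (c m / m`!%:R) * f ^+ m).
      move=> d; exists m.+1 => N mN.
      rewrite (bigD1 (Ordinal mN)) //= eqxx big1 ?addr0 ?subrr // => k.
      by rewrite -val_eqE /= => /negPf ->.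
    have := sumsD (substP f1 (fun l => int_extend c (l%:Z + 0)))
      (sumsM (-1) msum); rewrite mulN1r.
    by apply: eq_sums => l; rewrite mulN1r.
  apply: sums_ord => l; case: (ltngtP l m) => [lm|ml|->].
  - rewrite subr0 /int_extend addr0 /= c0 // => k k' _.
    by rewrite fpsCE !mul0r.
  - by rewrite subr0; apply/ordgeMl/(ordgeW ml)/ordge1X.
  - by rewrite /int_extend addr0 /= subrr.
have := Gtail i j; rewrite ijm ltnSn => /(_ isT) /eqP.
rewrite fps_coefB subr_eq0 fpsCE => /eqP ->.
have := coef_exp_lead f1 ijm; set x := f 1%N 0%N ^+ i; set y := f 0%N 1%N ^+ j.
set z := (f ^+ m) i j; set t := h 0%N 0%N 0%N; move=> E.
transitivity (c m / m`!%:R * t * (i`!%:R * j`!%:R * z)); first by ring.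
rewrite E; field.
by rewrite pnatr_eq0 -lt0n fact_gt0.
Qed.

Section Symbol.
Variables (n : nat) (B : nat -> nat -> fps K) (A : 'I_n -> fps K).
Hypothesis symbol : \poly_(i < n.+1) B i (n - i)%N =
  \prod_(k < n) ('X - (A k)%:P) :> {poly fps K}.

Lemma symbol_root k : \sum_(i < n.+1) B i (n - i)%N * A k ^+ i = 0.
Proof.
rewrite -(horner_poly _ (fun i => B i (n - i)%N)) symbol.
by rewrite (bigD1 k) //= hornerM hornerXsubC subrr mul0r.
Qed.

Lemma symbol_lead : B n 0%N = 1.
Proof.
have := congr1 (fun p : {poly fps K} => p`_n) symbol.
rewrite coef_poly ltnSn subnn => ->.
have /monicP := monic_prod_XsubC (index_enum 'I_n) xpredT A.
by rewrite lead_coefE size_prod_XsubC -[index_enum _]enumT size_enum_ord.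
Qed.

End Symbol.

End LeadingForms.

(** * Every solution is a sum of specializations *)

Section Spanning.
Variable K : numFieldType.
Implicit Types u v : fps K.

Lemma iter_derivationB (d : fps K -> fps K) i u v : derivation d ->
  iter i d (u - v) = iter i d u - iter i d v.
Proof.
move=> dP; elim: i => // i IH; rewrite !iterS IH.
by apply/eqP; rewrite eq_sym subr_eq -(derivationD dP) subrK.
Qed.

Lemma fps_opB n B u v : fps_op n B (u - v) = fps_op n B u - fps_op n B v.
Proof.
rewrite !fps_opE -sumrB; apply: eq_bigr => i _; rewrite -sumrB.
apply: eq_bigr => j _; rewrite iter_derivationB; last exact: derivation_dy.
rewrite iter_derivationB; last exact: derivation_dx.
by rewrite mulrBr.
Qed.

Lemma fps_op_sum0 n B I (r : seq I) (w : I -> fps K) :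
  (forall k, fps_op n B (w k) = 0) -> fps_op n B (\sum_(k <- r) w k) = 0.
Proof.
move=> w0; have B0 : fps_op n B 0 = 0.
  by have := fps_opB n B 0 0; rewrite !subrr.
have opD u v : fps_op n B (u + v) = fps_op n B u + fps_op n B v.
  by rewrite -[v in LHS]opprK -[- v]sub0r !fps_opB B0 sub0r opprK.
by rewrite (big_morph (fps_op n B) opD B0) big1.
Qed.

Theorem solutionsE n (B : nat -> nat -> fps K) (A f : 'I_n -> fps K) h u :
  \poly_(i < n.+1) B i (n - i)%N = \prod_(k < n) ('X - (A k)%:P) ->
  injective (fun k => A k 0%N 0%N) ->
  (forall i, normalized_solution n B (A i) (f i) (h i)) ->
  fps_solution n B u <->
  exists v : 'I_n -> fps K,
    (forall i : 'I_n, specialization (f i) (h i) (v i)) /\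
    (forall k l : nat, u k l = \sum_(i < n) v i k l).
Proof.
move=> symbol A_inj norm.
have f1 i : ordge 1 (f i) by have [_ f0 _ _ _] := norm i; exact: ordge1P.
have hP i : frac_solution n B (f i) (h i) by have [_ _ _] := norm i.
have h0 i : h i 0%N 0%N 0%N != 0 by have [_ _ _ _ h0] := norm i; exact/eqP.
have fx i : f i 1%N 0%N = A i 0%N 0%N * f i 0%N 1%N.
  have [/(_ 0%N 0%N) E _ _ _ _] := norm i; move: E => /eqP.
  by rewrite subr_eq0 fps_mulE fps_coefM00 => /eqP.
have fy i : f i 0%N 1%N != 0.
  have [_ _ /eqP nz _ _] := norm i; apply: contra_neq nz => fy0.
  by rewrite /fps_dx /fps_dy fx fy0 mulr0.
(* The degree is the first argument of [c], so that one stage of [recursive_choice] fixes the n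
   constants of that degree together. *)
pose S c := \sum_(i < n) spec (f i) (h i) (fun k : nat => c k i).
have S_sol c : fps_op n B (S c) = 0.
  by apply: fps_op_sum0 => i; apply: spec_solution.
have SB c c' : S (fun k => c k - c' k) = S c - S c'.
  by rewrite /S -sumrB; apply: eq_bigr => i _; rewrite -spec_sub.
have S_ordge m c : (forall k, (k < m)%N -> c k =1 fun=> 0) -> ordge m (S c).
  by move=> c0; apply: ordge_sum => i _; apply: spec_ordge => // k /c0.
split=> [usol|[v [vP uv]]]; last first.
  have vE i : exists c, v i = spec (f i) (h i) c.
    by apply/(specializationP (f1 i)).
  have [c cE] := choice vE.
  have -> : u = S (fun k i => c i k).
    apply: fpsP => k l; rewrite uv /S fps_coef_sum.
    by apply: eq_bigr => i _; rewrite cE.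
  by move=> k l; rewrite S_sol.
suff [c cP] : exists c : nat -> 'I_n -> K, forall m, ordge m.+1 (u - S c).
  exists (fun i => spec (f i) (h i) (c^~ i)); split=> [i|k l].
    by apply/specializationP => //; exists (c^~ i).
  have -> : u = S c by apply: ordge_eq => m; apply: ordgeW (cP m).
  by rewrite /S fps_coef_sum.
(* Locality holds because changing [c] beyond m alters [S c] only in degrees above m. *)
apply: (recursive_choice (fun=> 0)) => [m c c' cc' /= um|m c IH].
  rewrite -[u](subrK (S c)) -addrA -SB; apply: ordgeD => //.
  by apply: S_ordge => k km i; rewrite !fctE cc' ?subrr.
have um : ordge m (u - S c) by case: m IH => // m IH; apply: IH.
have opE : fps_op n B (u - S c) = 0.
  by rewrite fps_opB S_sol subr0; apply: fpsP.
(* The scaled degree m part of the remainder; by [lead_op] it satisfies the recurrence whose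
   characteristic polynomial is the symbol at the point. *)
pose p k := k`!%:R * (m - k)`!%:R * (u - S c) k (m - k)%N.
have [|k|k knm|g gE] := @recurrence_solution _ n (fun k => A k 0%N 0%N)
  (fun i => B i (n - i)%N 0%N 0%N) p m A_inj.
- by rewrite subnn (symbol_lead symbol).
- have E : (\sum_(i < n.+1) B i (n - i)%N * A k ^+ i) 0%N 0%N = 0.
    by rewrite (symbol_root symbol).
  rewrite -[RHS]E fps_coef_sum; apply: eq_bigr => i _.
  by rewrite fps_coefM00 fps_coefX00.
- by have := lead_op B um knm; rewrite opE mulr0 => <-.
(* By [spec_lead], a unit of [c m i] contributes [h i 0 0 0 * f i 0 1 ^+ m] times the geometric
   sequence of ratio [A i 0 0]; the division makes the contribution exactly [g i] times that
   sequence. *)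
exists (fun i => c m i + g i / (h i 0%N 0%N 0%N * f i 0%N 1%N ^+ m)).
set c' := fun k => _; pose e k := c' k - c k.
have e0 k : (k < m)%N -> e k =1 fun=> 0.
  by move=> km i; rewrite /e /c' ltn_eqF // fctE subrr.
have -> : u - S c' = u - S c - S e by rewrite SB opprB addrA subrK.
move=> i j; rewrite ltnS leq_eqVlt => /predU1P[ijm|ijm]; last first.
  by apply: (ordgeB um (S_ordge _ _ e0)).
rewrite fps_coefB [S e]/S fps_coef_sum; apply/eqP; rewrite subr_eq0; apply/eqP.
have ij0 : i`!%:R * j`!%:R != 0 :> K.
  by rewrite -natrM pnatr_eq0 -lt0n muln_gt0 !fact_gt0.
apply: (mulfI ij0); rewrite mulr_sumr.
have im : (i <= m)%N by rewrite -ijm leq_addr.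
have jE : j = (m - i)%N by rewrite -ijm addKn.
have := gE i im; rewrite /p -jE => ->; apply: eq_bigr => k _.
rewrite (@spec_lead _ _ _ _ m) // => [|l lm]; last exact: e0.
rewrite /e /c' !fctE eqxx fx exprMn.
have -> : f k 0%N 1%N ^+ m = f k 0%N 1%N ^+ i * f k 0%N 1%N ^+ j.
  by rewrite -exprD ijm.
by field; rewrite h0 !expf_neq0.
Qed.

End Spanning.

(** * Leading terms of T applied to a fractional-derivatives series *)

Section LeadingCoefficients.
Variable K : numFieldType.
Implicit Types (u v f : fps K) (g : gser K).

Lemma fps_coefM_local u v v' i j : (forall k, (k <= i)%N -> v k = v' k) ->
  (u * v) i j = (u * v') i j.
Proof.
move=> vv'; rewrite -!fps_mulE; apply: eq_bigr => k _; apply: eq_bigr => l _.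
by rewrite vv' // leq_subr.
Qed.

(** Formal Cauchy problem with datum [phi] on X = 0: the right-hand side in X-degree l uses h only
    up to X-degree l, and dividing by l + 1 gives the next coefficient. *)
Lemma transport_solution (A C r : fps K) (phi : nat -> K) :
  exists2 h, fps_dx h = A * fps_dy h + C * h + r & h 0%N = phi.
Proof.
pose F h := A * fps_dy h + C * h + r.
have F_local h h' i j : (forall k, (k <= i)%N -> h k = h' k) -> F h i j = F h' i j.
  move=> hh'; rewrite /F !fps_coefD (fps_coefM_local A (v' := fps_dy h')) => [|k ki].
    by rewrite (fps_coefM_local C (v' := h')).
  by apply/funext => l; rewrite /fps_dy hh'.
pose P l (h : nat -> nat -> K) :=
  if l is l'.+1 then forall j, fps_dx h l' j = F h l' j else h 0%N = phi.
have [[|l] h h' hh' /=|[|l] h IH|h hP] := @recursive_choice (nat -> K) (fun=> 0) P.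
- by rewrite hh'.
- move=> hF j; rewrite /fps_dx -hh' // -[LHS]/(fps_dx h l j) hF.
  by apply: F_local => k kl; rewrite hh' // leqW.
- by exists phi.
- exists (fun j => F h l j / l.+1%:R) => j.
  rewrite /fps_dx eqxx -[LHS]mulr_natr mulfVK ?pnatr_eq0 //.
  by apply: F_local => k kl; rewrite ltn_eqF.
by exists h; [apply: fpsP => i j; exact: (hP i.+1) | exact: (hP 0%N)].
Qed.

(** Geometric series in 1 - w / w(0), which has no constant term. *)
Lemma fps_inverse w : (w : fps K) 0%N 0%N != 0 -> exists w', w' * w = 1.
Proof.
move=> w0; pose c := fpsC (w 0%N 0%N)^-1; pose v := 1 - c * w.
have v1 : ordge 1 v.
  by apply: ordge1P; rewrite /v fps_coefB fpsCE mulVf // subrr.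
have vs := fsumP (fun m => ordge1X (m := m) v1).
exists (fsum (fun m => v ^+ m) * c); rewrite -mulrA.
have -> : c * w = 1 - v by rewrite opprB addrC subrK.
rewrite mulrBr mulr1 [_ * v]mulrC.
have := sumsD vs (sumsM (- v) vs); rewrite mulNr => /sums_unique; apply.
move=> d; exists d => N dN; apply: (ordgeW dN).
have -> : \sum_(k < N) (v ^+ k + - v * v ^+ k) = 1 - v ^+ N.
  elim: N {dN} => [|N IH]; first by rewrite big_ord0 expr0 subrr.
  by rewrite big_ord_recr IH /= exprS; ring.
by rewrite opprB addrC subrK; exact: ordge1X.
Qed.

Lemma gser_opB n B f g g' s :
  gser_op n B f (fun t => g t - g' t) s = gser_op n B f g s - gser_op n B f g' s.
Proof.
have derB d : derivation d -> forall g g',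
    gser_der d f (fun t => g t - g' t) = fun t => gser_der d f g t - gser_der d f g' t.
  move=> dP h h'; apply/funext => t; apply: fpsP => k l.
  rewrite fps_coefB /gser_der !fps_mulE mulrBr fps_coefB.
  have -> : d (h t - h' t) = d (h t) - d (h' t).
    exact: (@iter_derivationB _ _ 1).
  by rewrite fps_coefB; ring.
have iterB d i : derivation d -> forall g g',
    iter i (gser_der d f) (fun t => g t - g' t) =
    fun t => iter i (gser_der d f) g t - iter i (gser_der d f) g' t.
  by move=> dP h h'; elim: i => // i IH; rewrite iterS IH derB.
rewrite !gser_opE -sumrB; apply: eq_bigr => i _; rewrite -sumrB.
apply: eq_bigr => j _.
by rewrite !iterB ?mulrBr //; [exact: derivation_dx | exact: derivation_dy].
Qed.

Section LeadingTerms.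
Variable f : fps K.
Let fx := fps_dx f.
Let fy := fps_dy f.
Let Dx := gser_der (@fps_dx K) f.
Let Dy := gser_der (@fps_dy K) f.

Lemma gser_derE d g s : gser_der d f g s = d (g s) + d f * g (s - 1).
Proof. by []. Qed.

(** [kappa_y] and [kappa] accumulate the terms in which a derivative falls on the powers of df
    already produced. Only the fact that they do not depend on the series matters afterwards. *)
Let kappa_y j := iteri j (fun i k => fps_dy (fy ^+ i) + fy * k) 0.
Let kappa i j :=
  iteri i (fun i k => fps_dx (fx ^+ i * fy ^+ j) + fx * k) (kappa_y j).

Lemma iter_der_supp d i g s : derivation d -> (forall t, s < t -> g t = 0) ->
  forall t, s + i%:Z < t -> iter i (gser_der d f) g t = 0.
Proof.
move=> dP g0; elim: i => [|i IH] t st; first by apply: g0; lia.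
by rewrite iterS gser_derE !IH ?(derivation0 dP) ?mulr0 ?addr0 //; lia.
Qed.

Lemma iter_Dy_top j g s : (forall t, s < t -> g t = 0) ->
  iter j Dy g (s + j%:Z) = fy ^+ j * g s /\
  iter j Dy g (s + j%:Z - 1) =
    fy ^+ j * g (s - 1) + fy ^+ j.-1 *+ j * fps_dy (g s) + kappa_y j * g s.
Proof.
move=> g0; elim: j => [|j [IH1 IH2]].
  by rewrite addr0 !mul1r !mul0r !addr0.
have E : s + j.+1%:Z - 1 = s + j%:Z by lia.
split.
  rewrite iterS [LHS]gser_derE E IH1 (iter_der_supp (derivation_dy K) g0); last lia.
  by rewrite (derivation0 (derivation_dy K)) add0r exprS mulrA.
rewrite iterS E [LHS]gser_derE IH1 IH2 fps_dyM.
case: j {IH1 IH2 E} => [|j] /=; rewrite -/fy; first by ring.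
by rewrite !exprS; ring.
Qed.

(** From g_s, the top symbol arises when every derivative falls on G, the next one when exactly one
    derivative falls on g_s or on an earlier factor df. *)
Lemma iter_DxDy_top i j g s : (forall t, s < t -> g t = 0) ->
  iter i Dx (iter j Dy g) (s + (i + j)%:Z) = fx ^+ i * fy ^+ j * g s /\
  iter i Dx (iter j Dy g) (s + (i + j)%:Z - 1) =
    fx ^+ i * fy ^+ j * g (s - 1) +
    (fx ^+ i.-1 *+ i * fy ^+ j * fps_dx (g s) +
     fx ^+ i * (fy ^+ j.-1 *+ j) * fps_dy (g s)) + kappa i j * g s.
Proof.
move=> g0; elim: i => [|i [IH1 IH2]].
  rewrite add0n /=; have [-> ->] := iter_Dy_top j g0.
  split; first by rewrite mul1r.
  by rewrite /kappa /=; ring.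
have E : s + (i.+1 + j)%:Z - 1 = s + (i + j)%:Z by lia.
split.
  rewrite iterS [LHS]gser_derE E IH1.
  rewrite (iter_der_supp (derivation_dx K) (iter_der_supp (derivation_dy K) g0));
    last by lia.
  by rewrite (derivation0 (derivation_dx K)) add0r exprS !mulrA.
rewrite iterS E [LHS]gser_derE IH1 IH2 fps_dxM.
have -> : kappa i.+1 j = fps_dx (fx ^+ i * fy ^+ j) + fx * kappa i j by [].
case: i {IH1 IH2 E} => [|i] /=; rewrite -/fx; first by ring.
by rewrite !exprS; ring.
Qed.

Variables (n : nat) (B : nat -> nat -> fps K).

Lemma gser_op_supp g s t : (forall t, s < t -> g t = 0) -> s + n%:Z < t ->
  gser_op n B f g t = 0.
Proof.
move=> g0 st; rewrite gser_opE big1 // => i _; rewrite big1 // => j ij.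
rewrite (iter_der_supp (derivation_dx K) (iter_der_supp (derivation_dy K) g0))
  ?mulr0 //; lia.
Qed.

Lemma sum_homogeneous (F : nat -> nat -> fps K) :
  \sum_(i < n.+1) \sum_(j < n.+1 | (i + j <= n)%N)
     (if (i + j == n)%N then F i j else 0) = \sum_(i < n.+1) F i (n - i)%N.
Proof.
apply: eq_bigr => i _; have ilen : (i <= n)%N by rewrite -ltnS.
rewrite (bigD1 (inord (n - i))) /=; last by rewrite inordK; lia.
rewrite inordK; last by lia.
rewrite subnKC // eqxx big1 ?addr0 // => j /andP[_ jN]; case: eqP => // ijn.
by move: jN; rewrite -val_eqE /= inordK; lia.
Qed.

Lemma gser_op_top g s : (forall t, s < t -> g t = 0) ->
  gser_op n B f g (s + n%:Z) =
  (\sum_(i < n.+1) B i (n - i)%N * (fx ^+ i * fy ^+ (n - i))) * g s.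
Proof.
move=> g0; rewrite -(sum_homogeneous (fun i j => B i j * (fx ^+ i * fy ^+ j))).
rewrite gser_opE mulr_suml; apply: eq_bigr => i _; rewrite mulr_suml.
apply: eq_bigr => j ij; case: eqP => ijn.
  by have [E _] := iter_DxDy_top i j g0; rewrite ijn in E; rewrite E mulrA.
rewrite (iter_der_supp (derivation_dx K) (iter_der_supp (derivation_dy K) g0))
  ?mulr0 ?mul0r //; lia.
Qed.

Lemma gser_op_subtop : exists kap, forall g s, (forall t, s < t -> g t = 0) ->
  gser_op n B f g (s + n%:Z - 1) =
  (\sum_(i < n.+1) B i (n - i)%N * (fx ^+ i * fy ^+ (n - i))) * g (s - 1) +
  (\sum_(i < n.+1) B i (n - i)%N * (fx ^+ i.-1 *+ i * fy ^+ (n - i)))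
    * fps_dx (g s) +
  (\sum_(i < n.+1) B i (n - i)%N * (fx ^+ i * (fy ^+ (n - i).-1 *+ (n - i))))
    * fps_dy (g s) + kap * g s.
Proof.
(* Terms of order n contribute their [kappa], terms of order n - 1 their own top coefficient, and
   lower ones do not reach this symbol. *)
pose k i j := B i j * (if (i + j == n)%N then kappa i j else
  if (i + j).+1 == n then fx ^+ i * fy ^+ j else 0).
exists (\sum_(i < n.+1) \sum_(j < n.+1 | (i + j <= n)%N) k i j) => g s g0.
(* An opaque [S] spares the unifier the unfolding of sums of power series. *)
have [S SE] : {S : (nat -> nat -> fps K) -> fps K | forall F,
    S F = \sum_(i < n.+1) \sum_(j < n.+1 | (i + j <= n)%N) F i j}.
  by eexists.
have SD (F G : nat -> nat -> fps K) : S F + S G = S (fun i j => F i j + G i j).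
  by rewrite !SE -big_split; apply: eq_bigr => i _; rewrite -big_split.
have SM (F : nat -> nat -> fps K) c : S F * c = S (fun i j => F i j * c).
  by rewrite !SE mulr_suml; apply: eq_bigr => i _; rewrite mulr_suml.
have hom (F : nat -> nat -> fps K) c : (\sum_(i < n.+1) F i (n - i)%N) * c =
    S (fun i j => (if (i + j == n)%N then F i j else 0) * c).
  by rewrite -SM SE sum_homogeneous.
have E1 := hom (fun i j => B i j * (fx ^+ i * fy ^+ j)) (g (s - 1)).
have E2 := hom (fun i j => B i j * (fx ^+ i.-1 *+ i * fy ^+ j)) (fps_dx (g s)).
have E3 := hom (fun i j => B i j * (fx ^+ i * (fy ^+ j.-1 *+ j))) (fps_dy (g s)).
rewrite {}E1 {}E2 {}E3 -(SE k) SM !SD SE gser_opE.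
apply: eq_bigr => i _; apply: eq_bigr => j ij; rewrite /k.
case: eqP => ijn.
  by have [_ E] := iter_DxDy_top i j g0; rewrite ijn in E; rewrite E; ring.
case: eqP => ijn'.
  have -> : s + n%:Z - 1 = s + (i + j)%:Z by lia.
  by have [-> _] := iter_DxDy_top i j g0; ring.
rewrite (iter_der_supp (derivation_dx K) (iter_der_supp (derivation_dy K) g0));
  last by lia.
by rewrite !mulr0 !mul0r !addr0.
Qed.

End LeadingTerms.

End LeadingCoefficients.

(** * Existence of normalized solutions *)

Section Existence.
Variable K : numFieldType.
Variables (n : nat) (B : nat -> nat -> fps K) (A : 'I_n -> fps K).
Hypothesis symbol : \poly_(i < n.+1) B i (n - i)%N =
  \prod_(k < n) ('X - (A k)%:P) :> {poly fps K}.
Hypothesis A_inj : injective (fun k => A k 0%N 0%N).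

Lemma characteristic_solution (a : fps K) :
  exists f : fps K, [/\ fps_dx f = a * fps_dy f, f 0%N 0%N = 0 & fps_dy f 0%N 0%N = 1].
Proof.
(* The datum is Y on X = 0, which gives f(0) = 0 and d_y f(0) = 1. *)
have [f fE f0] := transport_solution a 0 0 (fun j => (j == 1%N)%:R).
exists f; split; first by rewrite fE mul0r !addr0.
  by rewrite f0.
by rewrite /fps_dy f0 mulr1n.
Qed.

Let Q := \poly_(i < n.+1) B i (n - i)%N.

Lemma symbol_deriv k :
  Q^`().[A k] = \sum_(i < n.+1) B i (n - i)%N * (A k ^+ i.-1 *+ i).
Proof.
rewrite /Q poly_def raddf_sum horner_sum; apply: eq_bigr => i _.
by rewrite /= derivZ derivXn hornerZ hornerMn hornerXn.
Qed.

(** The derivative at the root [A k] is the product of the [A k - A j] for j <> k, whose constant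
    terms are nonzero. *)
Lemma symbol_deriv_neq0 k : Q^`().[A k] 0%N 0%N != 0.
Proof.
rewrite /Q symbol (bigD1 k) //= derivM derivXsubC mul1r hornerD hornerM.
rewrite hornerXsubC subrr mul0r addr0 horner_prod fps_coef_prod00.
apply/prodf_neq0 => j jk; rewrite hornerXsubC fps_coefB subr_eq0.
by apply: contra_neq jk => /A_inj.
Qed.

Section OneFactor.
Variables (k : 'I_n) (f : fps K).
Hypothesis fA : fps_dx f = A k * fps_dy f.

Lemma symbol_df :
  \sum_(i < n.+1) B i (n - i)%N * (fps_dx f ^+ i * fps_dy f ^+ (n - i)) = 0.
Proof.
transitivity ((\sum_(i < n.+1) B i (n - i)%N * A k ^+ i) * fps_dy f ^+ n);
  last by rewrite (symbol_root symbol) mul0r.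
rewrite mulr_suml.
apply: eq_bigr => i _; rewrite fA exprMn -!mulrA -exprD subnKC //.
by rewrite -ltnS.
Qed.

Lemma symbol_dxi :
  \sum_(i < n.+1) B i (n - i)%N * (fps_dx f ^+ i.-1 *+ i * fps_dy f ^+ (n - i)) =
  fps_dy f ^+ n.-1 * Q^`().[A k].
Proof.
rewrite symbol_deriv mulr_sumr; apply: eq_bigr => -[[|i] /= iltn] _.
  by rewrite !mulr0n mul0r !mulr0.
have -> : n.-1 = (i + (n - i.+1))%N by lia.
by rewrite fA exprMn exprD; ring.
Qed.

(** Euler's relation: xi p_xi + eta p_eta = n p vanishes at df, which is proportional to ([A k], 1).
    Hence p_eta = - [A k] p_xi there, and the first-order part of the transport equation is a
    multiple of d_x - [A k] d_y. *)
Lemma symbol_deta :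
  \sum_(i < n.+1) B i (n - i)%N * (fps_dx f ^+ i * (fps_dy f ^+ (n - i).-1 *+ (n - i))) =
  - (fps_dy f ^+ n.-1 * Q^`().[A k]) * A k.
Proof.
apply/eqP; rewrite mulNr -addr_eq0 symbol_deriv mulr_sumr mulr_suml -big_split /=.
apply/eqP; transitivity ((\sum_(i < n.+1) B i (n - i)%N * A k ^+ i) *
    (fps_dy f ^+ n.-1 *+ n)); last by rewrite (symbol_root symbol) mul0r.
rewrite mulr_suml; apply: eq_bigr => -[i /= iltn] _.
set y := fps_dy f; set b := B i _; rewrite fA -/y exprMn.
have -> : A k ^+ i * y ^+ i * (y ^+ (n - i).-1 *+ (n - i)) =
    A k ^+ i * y ^+ n.-1 *+ (n - i).
  have [->|ni] := posnP (n - i); first by rewrite !mulr0n mulr0.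
  rewrite mulrnAr -mulrA -exprD; congr (_ * _ ^+ _ *+ _); lia.
have E : A k ^+ i.-1 *+ i * A k = A k ^+ i *+ i.
  by case: i {iltn b} => [|i]; rewrite ?mulr0n ?mul0r // mulrnAl -exprSr.
rewrite -[_ * _ * A k]mulrA -[_ * _ * A k]mulrA E.
have -> : n = (n - i + i)%N by lia.
rewrite [y ^+ _ *+ (_ + _)]mulrnDr addnK; ring.
Qed.

Lemma frac_solution_exists : fps_dy f 0%N 0%N != 0 ->
  exists2 h, frac_solution n B f h & h 0%N 0%N 0%N = 1.
Proof.
move=> fy0; have n_gt0 : (0 < n)%N by apply: leq_ltn_trans (ltn_ord k).
have [kap subtop] := gser_op_subtop f n B.
pose W := fps_dy f ^+ n.-1 * Q^`().[A k].
have [W' W'W] : exists W', W' * W = 1.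
  apply: fps_inverse; rewrite /W fps_coefM00 fps_coefX00.
  by rewrite mulf_neq0 ?expf_neq0 ?symbol_deriv_neq0.
have top g s : (forall t, s < t -> g t = 0) -> gser_op n B f g (s + n%:Z) = 0.
  by move=> g0; rewrite gser_op_top // symbol_df mul0r.
(* Stage l handles the coefficient of G^(n-1-l). Two series agreeing up to h_l differ by one
   starting at G^(-l-1), whose contribution here is its top coefficient, which is zero; this gives
   locality. *)
pose P l (h : nat -> fps K) := (l = 0%N -> h 0%N 0%N 0%N = 1) /\
  gser_op n B f (frac_series h) (- l%:Z + n%:Z - 1) = 0.
have [l h h' hh' [h0 hl]|l h IH|h hP] := @recursive_choice _ (0 : fps K) P.
- split=> [l0|]; first by rewrite -hh' ?h0 // l0.
  have := gser_opB n B f (frac_series h') (frac_series h) (- l%:Z + n%:Z - 1).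
  rewrite hl subr0 => <-.
  have -> : - l%:Z + n%:Z - 1 = - l.+1%:Z + n%:Z by lia.
  rewrite top // => t lt_t; rewrite /frac_series; case: ifP => t0; last exact: subrr.
  by rewrite hh' ?subrr //; lia.
(* By linearity, the coefficient is the residue [r] left by h_l = 0 plus the effect of the single
   term x G^(-l). Dividing by the unit [W] gives the transport equation for x, solved with datum 1
   on X = 0. *)
- pose upd x i := if i == l then x else h i.
  pose r := gser_op n B f (frac_series (upd 0)) (- l%:Z + n%:Z - 1).
  have [x xE x0] := transport_solution (A k) (- (W' * kap)) (- (W' * r))
    (fun j => (j == 0%N)%:R).
  exists x; split=> [->|]; first by rewrite /= x0.
  pose g t := frac_series (upd x) t - frac_series (upd 0) t.
  have g0 t : - l%:Z < t -> g t = 0.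
    rewrite /g /frac_series; case: ifP => t0 lt_t; last exact: subrr.
    have tl : (`|t|%N == l) = false by apply/negbTE; lia.
    by rewrite /upd tl subrr.
  have gx : g (- l%:Z) = x.
    by rewrite /g /frac_series oppr_le0 /= abszN /upd eqxx subr0.
  have := subtop g (- l%:Z) g0; rewrite gser_opB -/r gx.
  rewrite symbol_df mul0r add0r (symbol_dxi) (symbol_deta) -/W xE => /eqP.
  rewrite subr_eq => /eqP ->.
  have -> : W * (A k * fps_dy x + - (W' * kap) * x - W' * r) +
      - W * A k * fps_dy x + kap * x + r =
      (1 - W' * W) * (kap * x + r) by ring.
  by rewrite W'W subrr mul0r.
exists h; last by have [-> //] := hP 0%N.
move=> s i j; suff -> : gser_op n B f (frac_series h) s = 0 by [].
have h0 t : 0 < t -> frac_series h t = 0.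
  by rewrite /frac_series leNgt => ->.
(* Below n, the coefficient is the one treated at stage l = n - 1 - s. At n it is the symbol at df,
   and above n there are no terms. *)
have [sn|] := ltP s n%:Z.
  pose z : int := n%:Z - 1 - s; have [_] := hP `|z|%N.
  by have -> : - `|z|%N%:Z + n%:Z - 1 = s by rewrite /z; lia.
rewrite le_eqVlt => /predU1P[<-|ns]; first by have := top _ _ h0; rewrite add0r.
by apply: (@gser_op_supp _ _ _ _ _ 0) => //; rewrite add0r.
Qed.

End OneFactor.

Theorem normalized_solution_exists k :
  exists f h, normalized_solution n B (A k) f h.
Proof.
have [f [fA f0 fy1]] := characteristic_solution (A k).
have [|h hsol h1] := frac_solution_exists fA; first by rewrite fy1 oner_neq0.
exists f, h; split=> //.
- by move=> i j; rewrite fA subrr.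
- by rewrite fy1 => -[_ /eqP]; rewrite oner_eq0.
- by rewrite h1; apply/eqP/oner_neq0.
Qed.

End Existence.

(** * Convergence in C *)

Section ComplexPlane.
Variable R : realType.
Local Notation C := R[i].

Lemma ge0_complexE (x : C) : 0 <= x -> x = (complex.Re x)%:C.
Proof. by case: x => a b; rewrite lecE /= => /andP[/eqP -> _]. Qed.

Lemma normc_real (s : R) : `|s%:C| = `|s|%:C.
Proof. by rewrite normc_def /= expr0n /= addr0 sqrtr_sqr. Qed.

Lemma complex_archi (x : C) : 0 <= x -> exists N : nat, x < N%:R.
Proof.
move=> x0; have a0 : 0 <= complex.Re x by move: x0; rewrite lecE => /andP[].
exists (Num.bound (complex.Re x)); rewrite {1}(ge0_complexE x0).
by rewrite -(rmorph_nat (real_complex R)) ltcR archi_boundP.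
Qed.

Lemma half_pow_small (B e : C) : 0 <= B -> 0 < e ->
  exists N : nat, forall m, (N <= m)%N -> 2^-1 ^+ m * B < e.
Proof.
move=> B0 e0; have [N BN] := complex_archi (divr_ge0 B0 (ltW e0)).
exists N => m Nm; rewrite exprVn mulrC ltr_pdivrMr ?exprn_gt0 // mulrC.
rewrite -ltr_pdivrMr //; apply: (lt_le_trans BN).
by rewrite -natrX ler_nat (leq_trans Nm) // ltnW // ltn_expl.
Qed.

Lemma small_eq0 (x B : C) : (forall e, 0 < e -> `|x| <= e * B) -> x = 0.
Proof.
move=> xB; apply/eqP; apply: contraT => x0.
have B0 : 0 <= B.
  by rewrite -[B]mul1r; apply: le_trans (xB 1 ltr01).
have B1 : 0 < B + 1 by rewrite ltr_wpDl.
have e0 : 0 < `|x| / (B + 1) by rewrite divr_gt0 // normr_gt0.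
suff /lt_geF : `|x| / (B + 1) * B < `|x| by rewrite xB.
by rewrite -[ltRHS](divfK (lt0r_neq0 B1)) ltr_pM2l // ltrDl.
Qed.

Lemma nbhs2P (p : C * C) (P : set (C * C)) : (\forall q \near p, P q) <->
  exists2 e : C, 0 < e & forall q, `|q.1 - p.1| < e -> `|q.2 - p.2| < e -> P q.
Proof.
split.
  move/nbhs_ballP => [e /= e0 eP]; exists e => // q q1 q2; apply: eP.
  by split; rewrite -ball_normE /ball_ /= distrC.
move=> [e e0 eP]; apply/nbhs_ballP; exists e => // q [].
by rewrite -!ball_normE /ball_ /= => q1 q2; apply: eP; rewrite distrC.
Qed.

Lemma cvgCP (u : nat -> C) (l : C) : u @ \oo --> l <->
  forall e, 0 < e -> exists N, forall n, (N <= n)%N -> `|l - u n| < e.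
Proof.
split=> [ul e e0|H].
  by have /cvgrPdist_lt /(_ e e0) [N _ HN] := ul; exists N => n /HN.
by apply/cvgrPdist_lt => e /H [N HN]; exists N => // n /HN.
Qed.

Lemma cvgCM (u v : nat -> C) (a b : C) : u @ \oo --> a -> v @ \oo --> b ->
  (fun n => u n * v n) @ \oo --> a * b.
Proof. by move=> ua vb; exact: (@cvgM (C : numFieldType) nat \oo _ u v a b ua vb). Qed.

Lemma cvgCD (u v : nat -> C) (a b : C) : u @ \oo --> a -> v @ \oo --> b ->
  (fun n => u n + v n) @ \oo --> a + b.
Proof. by move=> ua vb; exact: (@cvgD (C : numFieldType) _ nat \oo _ u v a b ua vb). Qed.

Lemma cvg_dist_le (u : nat -> C) (l a X : C) m : u @ \oo --> l ->
  (forall N, (m <= N)%N -> `|u N - a| <= X) -> `|l - a| <= X.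
Proof.
move=> /cvgCP ul uX; have X0 : 0 <= X := le_trans (normr_ge0 _) (uX m (leqnn m)).
rewrite real_leNgt ?ger0_real //; apply/negP => Xla.
have [|N HN] := ul (`|l - a| - X); first by rewrite subr_gt0.
pose k := maxn N m; have := HN k (leq_maxl _ _); rewrite ltrBrDr => /lt_geF.
suff -> : `|l - a| <= `|l - u k| + X by [].
by apply: le_trans (ler_distD (u k) _ _) _; rewrite lerD2l uX // leq_maxr.
Qed.

End ComplexPlane.

(** * Taylor series *)

Section DoubleSums.
Variable V : nmodType.
Implicit Types F : nat -> nat -> V.

Lemma sum_triangle F m :
  \sum_(k < m) \sum_(i < k.+1) F i (k - i)%N = \sum_(i < m) \sum_(j < m - i) F i j.
Proof.
elim: m => [|m IH]; first by rewrite !big_ord0.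
rewrite big_ord_recr /= IH [RHS]big_ord_recr /= subSnn big_ord1.
rewrite [X in _ + X]big_ord_recr /= subnn addrA -big_split /=.
congr (_ + _); apply: eq_bigr => i _.
by rewrite subSn ?big_ord_recr //= ltnW.
Qed.

Lemma sum_ord_widen (G : nat -> V) m N : (m <= N)%N ->
  \sum_(i < m) G i = \sum_(i < N) if (i < m)%N then G i else 0.
Proof. by move=> mN; rewrite (big_ord_widen N G mN) big_mkcond. Qed.

Lemma sum_triangle_square F m N : (m <= N)%N ->
  \sum_(i < m) \sum_(j < m - i) F i j =
  \sum_(i < N) \sum_(j < N) if (i + j < m)%N then F i j else 0.
Proof.
move=> mN; rewrite (sum_ord_widen (fun i => \sum_(j < m - i) F i j) mN).
apply: eq_bigr => i _; case: ltnP => im; last first.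
  by rewrite big1 // => j _; case: ltnP => //; lia.
rewrite (sum_ord_widen (F i) (N := N)); last by lia.
by apply: eq_bigr => j _; congr (if _ then _ else _); lia.
Qed.

Lemma sum_monomial F a b N :
  \sum_(i < N) \sum_(j < N) (if (i == a :> nat) && (j == b :> nat) then F i j else 0) =
  if (a < N)%N && (b < N)%N then F a b else 0.
Proof.
transitivity (\sum_(i < N | i == a :> nat) \sum_(j < N | j == b :> nat) F i j).
  rewrite [RHS]big_mkcond; apply: eq_bigr => i _ /=.
  case: eqP => _ /=; last by rewrite big1.
  by rewrite [RHS]big_mkcond.
rewrite (big_ord1_eq _ (fun i : nat => \sum_(j < N | j == b :> nat) F i j)).
by case: ifP => //= aN; rewrite (big_ord1_eq _ (F a)).
Qed.

End DoubleSums.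

Section PartialSums.
Variable R : realType.
Local Notation C := R[i].
Implicit Types (c d : fps C) (z : C * C).

(** Sums by total degree replace the square partial sums because they behave well on lines through
    the centre. *)
Definition homog c m z : C := \sum_(i < m.+1) c i (m - i)%N * z.1 ^+ i * z.2 ^+ (m - i).

Definition abound c (r B : C) := forall N : nat,
  \sum_(i < N) \sum_(j < N) `|c i j| * r ^+ (i + j) <= B.

Lemma abound_ge0 c r B : abound c r B -> 0 <= B.
Proof. by move=> /(_ 0%N); rewrite big_ord0. Qed.

Lemma abound_le c r r' B : 0 <= r' -> r' <= r -> abound c r B -> abound c r' B.
Proof.
move=> r0 rr' cB N; apply: le_trans (cB N).
apply: ler_sum => i _; apply: ler_sum => j _; apply: ler_wpM2l => //.
by rewrite lerXn2r ?nnegrE // (le_trans r0).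
Qed.

Lemma common_radius (r1 r2 : C) : 0 < r1 -> 0 < r2 ->
  exists r, [/\ 0 < r, r <= r1 & r <= r2].
Proof.
move=> r1_gt0 r2_gt0; have r12 : 0 < r1 + r2 by rewrite addr_gt0.
(* Radii are elements of [R[i]], which is only partially ordered; this explicit quantity lies below
   both and needs no minimum. *)
exists (r1 * r2 / (r1 + r2)); rewrite divr_gt0 ?mulr_gt0 //; split=> //.
  by rewrite ler_pdivrMr // ler_pM2l // lerDr ltW.
by rewrite ler_pdivrMr // mulrC ler_pM2l // lerDl ltW.
Qed.

Lemma ratio_pow (rho r : C) m k : 0 <= rho -> 0 < r -> rho <= r -> (m <= k)%N ->
  rho ^+ k <= r ^+ k * (rho / r) ^+ m.
Proof.
move=> rho0 r0 rhor mk; have -> : rho = r * (rho / r) by rewrite mulrC divfK ?gt_eqF.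
rewrite [r * _ / r]mulrAC divff ?gt_eqF // mul1r exprMn.
apply: ler_wpM2l; first by rewrite exprn_ge0 // ltW.
by rewrite ler_wiXn2l // ?divr_ge0 ?(ltW r0) // ler_pdivrMr // mul1r.
Qed.

(** What remains has total degree at least m, and passing from radius r to rho multiplies the bound
    of each such term by at most (rho / r)^m. *)
Lemma psum_remainder c r B z rho m N : 0 < r -> abound c r B ->
  0 <= rho -> rho <= r -> `|z.1| <= rho -> `|z.2| <= rho -> (m <= N)%N ->
  `|fps_psum c z N - \sum_(k < m) homog c k z| <= (rho / r) ^+ m * B.
Proof.
move=> r0 cB rho0 rhor z1 z2 mN.
pose F i j := c i j * z.1 ^+ i * z.2 ^+ j.
rewrite (sum_triangle F) (sum_triangle_square F mN) -sumrB.
apply: le_trans (ler_norm_sum _ _ _) _.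
apply: le_trans (ler_wpM2l _ (cB N)); last first.
  by rewrite exprn_ge0 // divr_ge0 // ltW.
rewrite mulr_sumr; apply: ler_sum => i _; rewrite -sumrB mulr_sumr.
apply: le_trans (ler_norm_sum _ _ _) _; apply: ler_sum => j _.
case: ltnP => ijm.
  rewrite subrr normr0 !mulr_ge0 ?exprn_ge0 ?divr_ge0 //; exact: ltW.
rewrite subr0 !normrM !normrX mulrCA -mulrA ler_wpM2l //.
rewrite [leRHS]mulrC; apply: le_trans (ratio_pow rho0 r0 rhor ijm).
by rewrite exprD ler_pM ?exprn_ge0 // lerXn2r ?nnegrE.
Qed.

Lemma psum_mul c d z N : fps_psum (c * d) z N =
  \sum_(k < N) \sum_(k' < N) \sum_(l < N) \sum_(l' < N)
    if (k + k' < N)%N && (l + l' < N)%N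
    then c k l * z.1 ^+ k * z.2 ^+ l * (d k' l' * z.1 ^+ k' * z.2 ^+ l') else 0.
Proof.
pose G k k' l l' := c k l * z.1 ^+ k * z.2 ^+ l * (d k' l' * z.1 ^+ k' * z.2 ^+ l').
transitivity (\sum_(i < N) \sum_(k < i.+1) \sum_(j < N) \sum_(l < j.+1)
    G k (i - k)%N l (j - l)%N).
  apply: eq_bigr => i _; rewrite exchange_big; apply: eq_bigr => j _ /=.
  rewrite -fps_mulE /fps_mul -mulrA mulr_suml; apply: eq_bigr => k _.
  rewrite mulr_suml; apply: eq_bigr => l _; rewrite /G.
  have -> : z.1 ^+ i = z.1 ^+ k * z.1 ^+ (i - k) by rewrite -exprD subnKC ?leq_ord.
  have -> : z.2 ^+ j = z.2 ^+ l * z.2 ^+ (j - l) by rewrite -exprD subnKC ?leq_ord.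
  ring.
pose F k k' := \sum_(j < N) \sum_(l < j.+1) G k k' l (j - l)%N.
rewrite (sum_triangle F) (sum_triangle_square F (leqnn N)); apply: eq_bigr => k _.
apply: eq_bigr => k' _; rewrite /F (sum_triangle (G k k')).
rewrite (sum_triangle_square (G k k') (leqnn N)); case: ifP => _ //=.
by rewrite big1 // => l _; rewrite big1.
Qed.

Lemma psum_prod c d z N : fps_psum c z N * fps_psum d z N =
  \sum_(k < N) \sum_(k' < N) \sum_(l < N) \sum_(l' < N)
    c k l * z.1 ^+ k * z.2 ^+ l * (d k' l' * z.1 ^+ k' * z.2 ^+ l').
Proof.
rewrite /fps_psum mulr_suml; apply: eq_bigr => k _.
rewrite mulr_sumr; apply: eq_bigr => k' _; rewrite mulr_suml.
by apply: eq_bigr => l _; rewrite mulr_sumr.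
Qed.

Definition fps_abs c : fps C := fun i j => `|c i j|.

Lemma abound_psum c r N :
  \sum_(i < N) \sum_(j < N) `|c i j| * r ^+ (i + j) = fps_psum (fps_abs c) (r, r) N.
Proof.
by apply: eq_bigr => i _; apply: eq_bigr => j _; rewrite /= exprD mulrA.
Qed.

Lemma psum_abs_ge0 c N r : 0 <= r -> 0 <= fps_psum (fps_abs c) (r, r) N.
Proof.
move=> r0; apply: sumr_ge0 => i _; apply: sumr_ge0 => j _.
by rewrite !mulr_ge0 ?exprn_ge0 //; exact: normr_ge0.
Qed.

Lemma aboundM c d r B B' : 0 <= r -> abound c r B -> abound d r B' ->
  abound (c * d) r (B * B').
Proof.
move=> r0 cB dB N.
apply: (@le_trans _ _ (fps_psum (fps_abs c * fps_abs d) (r, r) N)).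
  apply: ler_sum => i _; apply: ler_sum => j _.
  rewrite exprD mulrA ler_wpM2r ?exprn_ge0 // ler_wpM2r ?exprn_ge0 //.
  rewrite -!fps_mulE; apply: le_trans (ler_norm_sum _ _ _) _.
  apply: ler_sum => k _; apply: le_trans (ler_norm_sum _ _ _) _.
  by apply: ler_sum => l _; rewrite normrM.
have := cB N; have := dB N; rewrite !abound_psum => dN cN.
have psum_ge0 e := psum_abs_ge0 e N r0.
apply: le_trans (ler_pM (psum_ge0 c) (psum_ge0 d) cN dN).
rewrite psum_mul psum_prod.
do 4!(apply: ler_sum => ? _).
by case: ifP => // _; rewrite !mulr_ge0 ?exprn_ge0 //; exact: normr_ge0.
Qed.

(** The two sides differ by the terms with k + k' >= N or l + l' >= N, which have total degree at
    least N. *)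
Lemma psum_mul_remainder c d r B B' z rho N : 0 < r -> abound c r B -> abound d r B' ->
  0 <= rho -> rho <= r -> `|z.1| <= rho -> `|z.2| <= rho ->
  `|fps_psum c z N * fps_psum d z N - fps_psum (c * d) z N| <= (rho / r) ^+ N * (B * B').
Proof.
move=> r0 cB dB rho0 rhor z1 z2; rewrite psum_prod psum_mul -sumrB.
have psum_ge0 e := psum_abs_ge0 e N (ltW r0).
apply: (@le_trans _ _ ((rho / r) ^+ N *
   (fps_psum (fps_abs c) (r, r) N * fps_psum (fps_abs d) (r, r) N))); last first.
  apply: ler_wpM2l; first by rewrite exprn_ge0 // divr_ge0 // ltW.
  by apply: ler_pM => //; rewrite -abound_psum.
rewrite psum_prod.
rewrite mulr_sumr; apply: le_trans (ler_norm_sum _ _ _) _; apply: ler_sum => k _.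
rewrite mulr_sumr -sumrB; apply: le_trans (ler_norm_sum _ _ _) _; apply: ler_sum => k' _.
rewrite mulr_sumr -sumrB; apply: le_trans (ler_norm_sum _ _ _) _; apply: ler_sum => l _.
rewrite mulr_sumr -sumrB; apply: le_trans (ler_norm_sum _ _ _) _; apply: ler_sum => l' _.
have r0' := ltW r0; have q0 : 0 <= rho / r by rewrite divr_ge0.
case: ifP => [_|kl].
  by rewrite subrr normr0 !mulr_ge0 ?exprn_ge0 //; exact: normr_ge0.
have Nt : (N <= k + l + (k' + l'))%N by move/negbT: kl; lia.
rewrite subr0 !normrM !normrX /=.
apply: (@le_trans _ _ (`|c k l| * `|d k' l'| * rho ^+ (k + l + (k' + l')))).
  rewrite !exprD [leLHS](_ : _ = `|c k l| * `|d k' l'| *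
    ((`|z.1| ^+ k * `|z.2| ^+ l) * (`|z.1| ^+ k' * `|z.2| ^+ l'))); last by ring.
  apply: ler_wpM2l; first by rewrite mulr_ge0.
  by rewrite !ler_pM ?mulr_ge0 ?exprn_ge0 // lerXn2r ?nnegrE.
apply: (@le_trans _ _ (`|c k l| * `|d k' l'| *
    (r ^+ (k + l + (k' + l')) * (rho / r) ^+ N))).
  by apply: ler_wpM2l; rewrite ?mulr_ge0 // ratio_pow.
by rewrite /fps_abs !exprD le_eqVlt; apply/orP; left; apply/eqP; ring.
Qed.

End PartialSums.

Section Taylor.
Variable R : realType.
Local Notation C := R[i].
Implicit Types (c d : fps C) (p q z : C * C) (f g : C * C -> C).

Lemma taylor_remainder f p c : taylor setT f p c -> exists e r B : C,
  [/\ 0 < e, 0 < r, e <= r, 0 <= B & forall z rho m, `|z.1| <= rho ->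
    `|z.2| <= rho -> rho < e ->
    `|f (p + z) - \sum_(k < m) homog c k z| <= (rho / r) ^+ m * B].
Proof.
move=> [[r r0 [B cB]] /nbhs2P [e0 e0_gt0 cf]].
have [e [e_gt0 er ee0]] := common_radius r0 e0_gt0.
exists e, r, B; split=> //; first exact: abound_ge0 cB.
move=> z rho m z1 z2 rhoe.
have rho0 : 0 <= rho := le_trans (normr_ge0 _) z1.
have fz : fps_psum c z @ \oo --> f (p + z).
  have -> : fps_psum c z = fps_psum c (p + z - p) by rewrite addrC addKr.
  have rhoe0 := lt_le_trans rhoe ee0.
  apply: cf => //.
    by rewrite -[X in `|X|]/(p.1 + z.1 - p.1) addrC addKr (le_lt_trans z1).
  by rewrite -[X in `|X|]/(p.2 + z.2 - p.2) addrC addKr (le_lt_trans z2).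
apply: (cvg_dist_le (m := m) fz) => N mN; apply: psum_remainder mN => //.
by apply: le_trans er; exact: ltW.
Qed.

Lemma taylor_val f p c : taylor setT f p c -> f p = c 0%N 0%N.
Proof.
move=> /taylor_remainder [e [r [B [e0 r0 er B0 H]]]].
have := H 0 0 1%N; rewrite !normr0 lexx e0 => /(_ isT isT isT).
rewrite big_ord1 /homog big_ord1 !expr0 !mulr1 mul0r expr1 mul0r addr0.
by rewrite normr_le0 subr_eq0 => /eqP.
Qed.

Lemma taylor_continuous f p c : taylor setT f p c ->
  forall e, 0 < e -> \forall q \near p, `|f q - f p| < e.
Proof.
move=> fc; have fp := taylor_val fc; move: fc.
move=> /taylor_remainder [e [r [B [e0 r0 er B0 H]]]] h h0.
have hB : 0 < h / (B + 1) * r by rewrite mulr_gt0 ?divr_gt0 // ltr_wpDl.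
have [s [s0 se sh]] := common_radius e0 hB.
apply/nbhs2P; exists (s / 2) => [|q q1 q2]; first by rewrite divr_gt0.
have s2 : s / 2 < s by rewrite gtr_pMr // invf_lt1 // ltr1n.
have := H (q - p) (s / 2) 1%N (ltW q1) (ltW q2) (lt_le_trans s2 se).
rewrite big_ord1 /homog big_ord1 !expr0 !mulr1 -fp [p + _]addrC subrK.
move=> /le_lt_trans; apply; rewrite expr1.
have B1 : 0 < B + 1 by rewrite ltr_wpDl.
apply: (@le_lt_trans _ _ (h / (B + 1) * B)).
  apply: ler_wpM2r => //; rewrite ler_pdivrMr //.
  exact: le_trans (ltW s2) sh.
by rewrite -[ltRHS](divfK (lt0r_neq0 B1)) ltr_pM2l ?ltrDl // divr_gt0.
Qed.

Lemma taylor_near f g p c : taylor setT f p c -> (\forall q \near p, f q = g q) ->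
  taylor setT g p c.
Proof.
move=> [cB fc] fg; split; first exact: cB.
by apply: filterS2 fg fc => q <- H _; exact: H.
Qed.

Lemma taylorM f g p c d : taylor setT f p c -> taylor setT g p d ->
  taylor setT (fun q => f q * g q) p (c * d).
Proof.
move=> [[r1 r1_gt0 [B cB1]] fc] [[r2 r2_gt0 [B' dB2]] gd].
have [r [r0 rr1 rr2]] := common_radius r1_gt0 r2_gt0.
have cB := abound_le (ltW r0) rr1 cB1; have dB := abound_le (ltW r0) rr2 dB2.
split; first by exists r => //; exists (B * B'); apply: aboundM => //; exact: ltW.
(* Half the radius makes the discrepancy at most 2^(-N) B B', which tends to 0. *)
have r2' : r / 2 <= r by rewrite ler_pdivrMr // ler_peMr ?(ltW r0) // ler1n.
have qr : \forall q \near p, `|(q - p).1| <= r / 2 /\ `|(q - p).2| <= r / 2.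
  apply/nbhs2P; exists (r / 2); first by rewrite divr_gt0.
  by move=> q q1 q2; split; apply: ltW.
apply: filterS3 fc gd qr => q fq gq [q1 q2] _; move: (fq I) (gq I) => {}fq {}gq.
have fgq : (fun N => fps_psum c (q - p) N * fps_psum d (q - p) N) @ \oo --> f q * g q.
  exact: cvgCM.
move/cvgCP : fgq => fgq; apply/cvgCP => e e0.
have e2 : 0 < e / 2 by rewrite divr_gt0.
have [N1 H1] := fgq _ e2.
have BB : 0 <= B * B' by rewrite mulr_ge0 // (abound_ge0 cB, abound_ge0 dB).
have [N2 H2] := half_pow_small BB e2.
exists (maxn N1 N2) => N; rewrite geq_max => /andP[NN1 NN2].
rewrite [e]splitr; apply: le_lt_trans (ler_distD _ _ _) (ltrD (H1 N NN1) _).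
apply: le_lt_trans (H2 N NN2).
have := psum_mul_remainder N r0 cB dB _ r2' q1 q2.
rewrite mulrAC divff ?gt_eqF // mul1r; apply.
by rewrite divr_ge0 // ltW.
Qed.

Lemma taylor_monomial (x : C) a b p :
  taylor setT (fun q => x * (q.1 - p.1) ^+ a * (q.2 - p.2) ^+ b) p
    (fun i j => if (i == a) && (j == b) then x else 0).
Proof.
split.
  exists 1 => //; exists `|x| => N.
  rewrite [leLHS](_ : _ = if (a < N)%N && (b < N)%N then `|x| else 0).
    by case: ifP.
  rewrite -(sum_monomial (fun _ _ => `|x|)).
  apply: eq_bigr => i _; apply: eq_bigr => j _.
  by rewrite expr1n mulr1; case: ifP; rewrite ?normr0.
apply/nbhs2P; exists 1 => // q _ _ _; apply/cvgCP => e e0; exists (maxn a b).+1 => N.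
rewrite gtn_max => /andP[aN bN].
rewrite /fps_psum (_ : \sum_(i < N) _ = x * (q.1 - p.1) ^+ a * (q.2 - p.2) ^+ b).
  by rewrite subrr normr0.
have := sum_monomial (fun i j => x * (q.1 - p.1) ^+ i * (q.2 - p.2) ^+ j) a b N.
rewrite aN bN /= => <-.
apply: eq_bigr => i _; apply: eq_bigr => j _.
by case: ifP; rewrite ?mul0r.
Qed.

Lemma taylorD f g p c d : taylor setT f p c -> taylor setT g p d ->
  taylor setT (fun q => f q + g q) p (c + d).
Proof.
move=> [[r1 r1_gt0 [B cB1]] fc] [[r2 r2_gt0 [B' dB2]] gd].
have [r [r0 rr1 rr2]] := common_radius r1_gt0 r2_gt0.
have cB := abound_le (ltW r0) rr1 cB1; have dB := abound_le (ltW r0) rr2 dB2.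
have psumD z N : fps_psum (c + d) z N = fps_psum c z N + fps_psum d z N.
  rewrite /fps_psum -big_split; apply: eq_bigr => i _ /=; rewrite -big_split.
  by apply: eq_bigr => j _ /=; rewrite fps_coefD !mulrDl.
split.
  exists r => //; exists (B + B') => N; apply: le_trans (lerD (cB N) (dB N)).
  rewrite -big_split; apply: ler_sum => i _ /=; rewrite -big_split.
  apply: ler_sum => j _ /=; rewrite -mulrDl; apply: ler_wpM2r.
    by rewrite exprn_ge0 // ltW.
  exact: ler_normD.
apply: filterS2 fc gd => q fq gq _.
have -> : fps_psum (c + d) (q - p) =
    fun N => fps_psum c (q - p) N + fps_psum d (q - p) N.
  by apply/funext => N; exact: psumD.
by apply: cvgCD; [exact: fq | exact: gq].
Qed.

Lemma taylor_cst (x : C) p : taylor setT (fun=> x) p (fpsC x).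
Proof.
have := taylor_monomial x 0 0 p.
have -> : (fun i j => if (i == 0%N) && (j == 0%N) then x else 0) = fpsC x.
  by apply: fpsP => i j; rewrite fps_coefC; case: ifP; rewrite ?mulr1 ?mulr0.
by move=> H; apply: taylor_near H _; apply/nbhs2P; exists 1 => // q _ _; rewrite !mulr1.
Qed.

Lemma taylorN f p c : taylor setT f p c -> taylor setT (fun q => - f q) p (- c).
Proof.
move=> fc; have := taylorM (taylor_cst (-1) p) fc.
have -> : fpsC (-1) * c = - c by apply: fpsP => i j; rewrite fpsCE mulN1r.
by move=> H; apply: taylor_near H _; apply/nbhs2P; exists 1 => // q _ _; rewrite mulN1r.
Qed.

Lemma taylorB f g p c d : taylor setT f p c -> taylor setT g p d ->
  taylor setT (fun q => f q - g q) p (c - d).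
Proof. by move=> fc gd; apply: taylorD fc (taylorN gd). Qed.

End Taylor.

(** * Taylor series along a line *)

Section Identity.
Variable R : realType.
Local Notation C := R[i].
Implicit Types (c d : fps C) (p q z v : C * C) (f g : C * C -> C).

Definition scale2 (t : C) v : C * C := (t * v.1, t * v.2).

Lemma homog_scale c m t v : homog c m (scale2 t v) = t ^+ m * homog c m v.
Proof.
rewrite /homog mulr_sumr; apply: eq_bigr => i _ /=.
have -> : t ^+ m = t ^+ i * t ^+ (m - i) by rewrite -exprD subnKC ?leq_ord.
by rewrite !exprMn; ring.
Qed.

Definition size2 v : C := `|v.1| + `|v.2| + 1.

Lemma size2_gt0 v : 0 < size2 v.
Proof. by rewrite ltr_wpDl // addr_ge0. Qed.

Lemma norm_scale2 t v : `|(scale2 t v).1| <= `|t| * size2 v /\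
  `|(scale2 t v).2| <= `|t| * size2 v.
Proof.
by split; rewrite normrM ler_wpM2l // /size2 -?addrA ?lerDl ?addr_ge0 //
  addrCA lerDl addr_ge0.
Qed.

(** Isolated zeros in the parameter t: once the lower parts vanish on v, dividing the remainder
    estimate by |t|^m bounds the m-th part by a multiple of |t|, for arbitrarily small t. *)
Lemma homog_line f p c v : taylor setT f p c ->
  (forall e, 0 < e -> exists t, [/\ t != 0, `|t| < e & f (p + scale2 t v) = 0]) ->
  forall m, homog c m v = 0.
Proof.
move=> /taylor_remainder [e [r [B [e0 r0 er B0 H]]]] ft m.
have [k] := ubnP m; elim: k m => // k IH m; rewrite ltnS => mk.
pose V := size2 v; have V0 : 0 < V := size2_gt0 v.
apply: (@small_eq0 _ _ ((V / r) ^+ m.+1 * B)) => h h0.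
have [s [s0 sh se]] := common_radius h0 (divr_gt0 e0 V0).
have [t [t0 ts ft0]] := ft s s0; have [t1 t2] := norm_scale2 t v.
have tV : `|t| * V < e by rewrite -ltr_pdivlMr // (lt_le_trans ts).
have := H _ _ m.+1 t1 t2 tV; rewrite ft0 sub0r normrN.
rewrite big_ord_recr /= big1 => [|i _]; last first.
  by rewrite homog_scale IH ?mulr0 // (leq_trans _ mk).
rewrite add0r homog_scale normrM normrX -mulrA exprMn exprS -!mulrA mulrCA.
rewrite ler_pM2l ?exprn_gt0 ?normr_gt0 // => /le_trans; apply.
apply: ler_wpM2r; last exact: le_trans (ltW ts) sh.
by rewrite mulr_ge0 // exprn_ge0 // divr_ge0 // ltW.
Qed.

Lemma line_vanish f p c v : taylor setT f p c -> (forall m, homog c m v = 0) ->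
  exists2 e, 0 < e & forall t, `|t| < e -> f (p + scale2 t v) = 0.
Proof.
move=> /taylor_remainder [e [r [B [e0 r0 er B0 H]]]] c0.
pose V := size2 v; have V0 : 0 < V := size2_gt0 v.
have [s [s0 se sr]] := common_radius e0 (divr_gt0 r0 (ltr0n _ 2)).
exists (s / V) => [|t ts]; first by rewrite divr_gt0.
have [t1 t2] := norm_scale2 t v.
have tV : `|t| * V < s by rewrite -ltr_pdivlMr.
apply: (@small_eq0 _ _ 1) => h h0; rewrite mulr1.
have [N HN] := half_pow_small B0 h0.
have := H _ _ N t1 t2 (lt_le_trans tV se).
rewrite big1 ?subr0 => [Hf|i _]; last by rewrite homog_scale c0 mulr0.
apply: ltW; apply: le_lt_trans (HN N (leqnn N)); apply: le_trans Hf _.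
apply: ler_wpM2r => //; rewrite lerXn2r ?nnegrE //.
- by rewrite divr_ge0 ?mulr_ge0 // ltW.
- by rewrite invr_ge0.
by rewrite ler_pdivrMr // [leRHS]mulrC (le_trans (ltW tV)).
Qed.

(** Freezing the second coordinate at some y leaves a polynomial of degree at most m in the first
    with more than m roots; y must be nonzero for its coefficients c_i y^(m-i) to reveal the c_i. *)
Lemma homog_eq0 c m v0 e : 0 < e ->
  (forall v, `|v.1 - v0.1| < e -> `|v.2 - v0.2| < e -> homog c m v = 0) ->
  forall i, (i <= m)%N -> c i (m - i)%N = 0.
Proof.
move=> e0 cv; have [y y0 ye] : exists2 y : C, y != 0 & `|y - v0.2| < e.
  have [v20|v20] := eqVneq v0.2 0; last by exists v0.2; rewrite // subrr normr0.
  exists (e / 2); first by rewrite gt_eqF // divr_gt0.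
  rewrite v20 subr0 ger0_norm ?divr_ge0 ?(ltW e0) //.
  by rewrite gtr_pMr // invf_lt1 // ltr1n.
pose P := \poly_(i < m.+1) (c i (m - i)%N * y ^+ (m - i)).
suff P0 : P = 0.
  move=> i im; have /eqP := congr1 (fun Q : {poly C} => Q`_i) P0.
  rewrite coef0 coef_poly ltnS im mulf_eq0 expf_eq0 (negPf y0) andbF orbF.
  by move/eqP.
pose x (k : nat) := v0.1 + e / k.+2%:R.
have Px k : P.[x k] = 0.
  rewrite horner_poly -[RHS](cv (x k, y)) //=; last first.
    rewrite addrAC subrr add0r ger0_norm ?divr_ge0 ?(ltW e0) //.
    by rewrite gtr_pMr // invf_lt1 ?ltr1n // ltr0n.
  by apply: eq_bigr => i _ /=; rewrite mulrAC.
apply/eqP; apply: contraT => /max_poly_roots /(_ (_ : all (root P) (map x (iota 0 m.+1)))).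
have -> : all (root P) [seq x i | i <- iota 0 m.+1].
  by apply/allP => _ /mapP[k _ ->]; apply/rootP.
rewrite map_inj_uniq ?iota_uniq => [/(_ isT isT)|k l].
  by rewrite size_map size_iota ltnNge size_poly.
move=> /addrI /(mulfI (lt0r_neq0 e0)) /invr_inj /eqP.
by rewrite eqr_nat => /eqP [].
Qed.

Lemma taylor0_near f p : taylor setT f p 0 -> \forall q \near p, f q = 0.
Proof.
move=> /taylor_remainder [e [r [B [e0 r0 er B0 H]]]].
have [s [s0 se sr]] := common_radius e0 (divr_gt0 r0 (ltr0n _ 2)).
apply/nbhs2P; exists (s / 2) => [|q q1 q2]; first by rewrite divr_gt0.
have s2 : s / 2 < s by rewrite gtr_pMr // invf_lt1 // ltr1n.
apply: (@small_eq0 _ _ 1) => h h0; rewrite mulr1.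
have [N HN] := half_pow_small B0 h0.
have := H (q - p) _ N (ltW q1) (ltW q2) (lt_le_trans s2 se).
rewrite [p + _]addrC subrK big1 ?subr0 => [Hf|i _]; last first.
  by rewrite /homog big1 // => j _; rewrite fps_coef0 !mul0r.
apply: ltW; apply: le_lt_trans (HN N (leqnn N)); apply: le_trans Hf _.
apply: ler_wpM2r => //; rewrite lerXn2r ?nnegrE //.
- by rewrite !divr_ge0 // ltW.
- by rewrite invr_ge0.
by rewrite ler_pdivrMr // [leRHS]mulrC (le_trans (ltW s2)).
Qed.

Lemma near_vanish_line f p : (\forall q \near p, f q = 0) -> forall v,
  exists2 e, 0 < e & forall t, `|t| < e -> f (p + scale2 t v) = 0.
Proof.
move=> /nbhs2P [e e0 fe] v; pose V := size2 v; have V0 : 0 < V := size2_gt0 v.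
exists (e / V) => [|t]; first by rewrite divr_gt0.
rewrite ltr_pdivlMr // => tV; have [t1 t2] := norm_scale2 t v; apply: fe.
  by rewrite -[X in `|X|]/(p.1 + (scale2 t v).1 - p.1) addrC addKr (le_lt_trans t1).
by rewrite -[X in `|X|]/(p.2 + (scale2 t v).2 - p.2) addrC addKr (le_lt_trans t2).
Qed.

Lemma taylor_near0 f p c : taylor setT f p c -> (\forall q \near p, f q = 0) -> c = 0.
Proof.
move=> fc f0; have c0 v m : homog c m v = 0.
  apply: (homog_line fc) => e e0; have [e' e'0 fe'] := near_vanish_line f0 v.
  have [s [s0 se se']] := common_radius e0 e'0.
  have s2 : `|s / 2| < s.
    by rewrite ger0_norm ?divr_ge0 ?(ltW s0) // gtr_pMr // invf_lt1 // ltr1n.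
  exists (s / 2); split; first by rewrite gt_eqF ?divr_gt0.
    exact: lt_le_trans se.
  by apply: fe'; exact: lt_le_trans se'.
apply: fpsP => i j; have := @homog_eq0 c (i + j) 0 1 ltr01 _ i (leq_addr _ _).
by rewrite addKn; apply => v _ _; exact: c0.
Qed.

Lemma taylor_unique f p c d : taylor setT f p c -> taylor setT f p d -> c = d.
Proof.
move=> fc fd; apply/eqP; rewrite -subr_eq0; apply/eqP.
apply: taylor_near0 (taylorB fc fd) _.
by apply/nbhs2P; exists 1 => // q _ _; rewrite subrr.
Qed.

End Identity.

(** * The identity theorem *)

Section IdentityTheorem.
Variable R : realType.
Local Notation C := R[i].
Implicit Types (c d : fps C) (p q z v : C * C) (f g : C * C -> C).

Lemma gt0_complex (e : C) : 0 < e -> exists2 s : R, 0 < s & s%:C = e.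
Proof.
move=> e0; exists (complex.Re e); last by rewrite -ge0_complexE // ltW.
by move: e0; rewrite ltcE => /andP[].
Qed.

Lemma scale2D (s t : C) v : scale2 (s + t) v = scale2 s v + scale2 t v.
Proof. by rewrite /scale2 !mulrDl. Qed.

Lemma scale2_1 v : scale2 1 v = v.
Proof. by case: v => x y; rewrite /scale2 !mul1r. Qed.

Lemma scale2_0 v : scale2 0 v = 0.
Proof. by rewrite /scale2 !mul0r. Qed.

(** Continuation from p + v back to p. At the infimum s0 of the parameters from which f vanishes up
    to 1, zeros accumulate from above, so all homogeneous parts vanish along v. Then f vanishes also
    below s0, which forces s0 = 0. *)
Lemma segment_vanish f p v c :
  (forall s : R, 0 <= s <= 1 -> exists d, taylor setT f (p + scale2 s%:C v) d) ->
  (\forall q \near p + v, f q = 0) -> taylor setT f p c ->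
  forall m, homog c m v = 0.
Proof.
move=> hol f0 fc; pose phi (s : R) := f (p + scale2 s%:C v).
have [eta eta0 phi1] : exists2 eta : R, 0 < eta &
    forall s, `|s - 1| < eta -> phi s = 0.
  have [e /gt0_complex[eta eta0 <-] He] := near_vanish_line f0 v.
  exists eta => // s; rewrite -ltcR -normc_real => /He.
  rewrite -addrA -[X in p + (X + _)]scale2_1 -scale2D rmorphB rmorph1.
  by rewrite [1 + _]addrC subrK.
pose E := [set s : R | 0 <= s <= 1 /\ forall t, s <= t <= 1 -> phi t = 0].
have E1 : E 1.
  split=> [|t /andP[t1 t1']]; first by rewrite ler01 lexx.
  by apply: phi1; rewrite (@le_anti _ _ t 1) ?t1 ?t1' // subrr normr0.
have Elb : lbound E 0 by move=> s [/andP[]].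
have Einf : has_inf E by split; [exists 1 | exists 0].
pose s0 := inf E.
have s0_ge0 : 0 <= s0 by apply: lb_le_inf => //; exists 1.
have s0_le1 : s0 <= 1 by apply: (inf_lbound Einf.2).
have phi_gt s : s0 < s -> s < 1 + eta -> phi s = 0.
  move=> s0s s1; have [s_le1|s_gt1] := leP s 1; last first.
    by apply: phi1; rewrite ger0_norm ?subr_ge0 ?ltW // ltrBlDl.
  have [|x [_ xE]] := @inf_adherent _ E (s - s0) _ Einf; first by rewrite subr_gt0.
  by rewrite addrC subrK => xs; apply: xE; rewrite (ltW xs).
have H0 d : taylor setT f (p + scale2 s0%:C v) d -> forall m, homog d m v = 0.
  move=> fd; apply: (homog_line fd) => e /gt0_complex[r r0 <-].
  pose t := Num.min r eta / 2.
  have rm0 : 0 < Num.min r eta by rewrite lt_min r0.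
  have t0 : 0 < t by rewrite divr_gt0.
  have tm : t < Num.min r eta by rewrite gtr_pMr // invf_lt1 // ltr1n.
  exists t%:C; split.
  - by rewrite gt_eqF // ltcR.
  - rewrite normc_real ltcR gtr0_norm // (lt_le_trans tm) //.
    by rewrite ge_min lexx.
  rewrite -addrA -scale2D -rmorphD; apply: phi_gt; first by rewrite ltrDl.
  by rewrite ler_ltD // (lt_le_trans tm) // ge_min lexx orbT.
have s00 : s0 = 0.
  apply/eqP; rewrite eq_le s0_ge0 andbT leNgt; apply/negP => s0_gt0.
  have [|d fd] := hol s0; first by rewrite s0_ge0.
  have [e /gt0_complex[r r0 <-] fe] := line_vanish fd (H0 d fd).
  (* r / 2 keeps strictly inside the interval of vanishing, and s0 keeps s0 - t in the segment. *)
  pose t := Num.min (r / 2) s0.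
  have t0 : 0 < t by rewrite lt_min divr_gt0.
  have tr : t < r.
    by rewrite gt_min; apply/orP; left; rewrite gtr_pMr // invf_lt1 // ltr1n.
  have ts0 : t <= s0 by rewrite ge_min lexx orbT.
  suff Et : E (s0 - t).
    have : s0 <= s0 - t by apply: (inf_lbound Einf.2).
    by rewrite lerBrDr gerDl leNgt t0.
  split=> [|s /andP[ts s1]].
    by rewrite subr_ge0 ts0 /= lerBlDr (le_trans s0_le1) // lerDl ltW.
  have [ss0|s0s] := leP s s0; last by apply: phi_gt => //; rewrite ltr_pwDr // ltr01.
  have := fe (s - s0)%:C; rewrite normc_real ltcR ler0_norm ?subr_le0 // opprB.
  rewrite -addrA -scale2D -rmorphD [s0 + (s - s0)]addrC subrK; apply.
  by rewrite (le_lt_trans _ tr) // lerBlDl -lerBlDr.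
by apply: H0; rewrite s00 rmorph0 scale2_0 addr0.
Qed.

(** Every v close to z - p satisfies the hypotheses of [segment_vanish], so each homogeneous part at
    p vanishes on an open set of directions, hence identically. *)
Lemma identity_near f p e z :
  0 < e -> (forall q, `|q.1 - p.1| < e -> `|q.2 - p.2| < e ->
     exists c, taylor setT f q c) ->
  `|z.1 - p.1| < e -> `|z.2 - p.2| < e ->
  (\forall q \near z, f q = 0) -> \forall q \near p, f q = 0.
Proof.
move=> e0 hol z1 z2 /nbhs2P [d d0 fd].
have [||c fc] := hol p; rewrite ?subrr ?normr0 //.
suff c0 : c = 0 by apply: taylor0_near; rewrite -c0.
have e1 : 0 < e - `|z.1 - p.1| by rewrite subr_gt0.
have e2 : 0 < e - `|z.2 - p.2| by rewrite subr_gt0.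
have [s1 [s1_gt0 s1e1 s1e2]] := common_radius e1 e2.
(* The bound by s1 keeps p + v in the bidisc of radius e; the bound d / 2 leaves room around p + v
   inside the region where f vanishes. *)
have [s [s0 ss1 sd]] := common_radius s1_gt0 (divr_gt0 d0 (ltr0n _ 2)).
apply: fpsP => i j.
have := @homog_eq0 _ c (i + j) (z - p) s s0 _ i (leq_addr _ _).
rewrite addKn; apply => v v1 v2.
have tri (x y : C) : `|x - y| < s -> s <= e - `|y| -> `|x| < e.
  move=> xy se; rewrite -[x](subrK y); apply: le_lt_trans (ler_normD _ _) _.
  by rewrite -ltrBrDr (lt_le_trans xy).
have ve1 : `|v.1| < e := tri v.1 (z.1 - p.1) v1 (le_trans ss1 s1e1).
have ve2 : `|v.2| < e := tri v.2 (z.2 - p.2) v2 (le_trans ss1 s1e2).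
apply: (@segment_vanish f p) => // [t /andP[t0 t1]|].
  have tn x : `|x| < e -> `|t%:C * x| < e.
    move=> xe; apply: le_lt_trans xe; rewrite normrM normc_real (ger0_norm t0).
    by apply: ler_piMl => //; rewrite -[leRHS]/(1%:C) lecR.
  apply: hol.
    by rewrite -[X in `|X|]/(p.1 + t%:C * v.1 - p.1) addrC addKr tn.
  by rewrite -[X in `|X|]/(p.2 + t%:C * v.2 - p.2) addrC addKr tn.
apply/nbhs2P; exists (d / 2) => [|q q1 q2]; first by rewrite divr_gt0.
have half (x y w t : C) : `|x - (y + w)| < d / 2 -> `|w - (t - y)| < s -> `|x - t| < d.
  move=> xyw ws; rewrite (_ : x - t = (x - (y + w)) + (w - (t - y))); last by ring.
  apply: le_lt_trans (ler_normD _ _) _; rewrite [d]splitr ltrD //.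
  exact: lt_le_trans sd.
by apply: fd; [apply: half q1 v1 | apply: half q2 v2].
Qed.

End IdentityTheorem.

(** * Analytic subsets *)

Section AnalyticSets.
Variable R : realType.
Local Notation C := R[i].
Implicit Types (M S Z U : set (C * C)) (p q : C * C) (f : C * C -> C).

Lemma holomorphic_on_sub U U' f : U `<=` U' -> holomorphic_on U' f -> holomorphic_on U f.
Proof. by move=> UU' hf p /UU'; exact: hf. Qed.

Lemma taylor_neq0_near f p c : taylor setT f p c -> f p != 0 ->
  \forall q \near p, f q != 0.
Proof.
move=> fc fp; have := taylor_continuous fc; move=> /(_ `|f p|); rewrite normr_gt0 => /(_ fp).
apply: filterS => q; apply: contraTneq => ->.
by rewrite sub0r normrN ltxx.
Qed.

Definition zero_set_at Z p := exists U m (g : 'I_m -> C * C -> C),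
  [/\ open_nbhs p U, forall i, holomorphic_on U (g i)
    & forall q, U q -> (Z q <-> forall i, g i q = 0)].

Lemma open_nbhsI p U U' : open_nbhs p U -> open_nbhs p U' -> open_nbhs p (U `&` U').
Proof. by move=> [oU Up] [oU' Up']; split; [exact: openI | split]. Qed.

(** The pairwise products of the equations cut out the union. *)
Lemma zero_set_atU p Z Z' : zero_set_at Z p -> zero_set_at Z' p ->
  zero_set_at (Z `|` Z') p.
Proof.
move=> [U [m [g [pU gU Zg]]]] [U' [m' [g' [pU' gU' Zg']]]].
exists (U `&` U'), #|{: 'I_m * 'I_m'}|.
exists (fun k q => g (enum_val k).1 q * g' (enum_val k).2 q).
split; first exact: open_nbhsI.
  move=> k q [Uq U'q]; have [c gc] := gU (enum_val k).1 q Uq.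
  by have [d gd] := gU' (enum_val k).2 q U'q; exists (c * d); exact: (taylorM gc gd).
move=> q [Uq U'q]; split.
  by move=> [/(Zg q Uq) g0|/(Zg' q U'q) g0] k; rewrite g0 ?mul0r ?mulr0.
move=> gg0; have [g0|/existsNP [i gi]] := pselect (forall i, g i q = 0).
  by left; apply/Zg.
right; apply/Zg' => // j; have := gg0 (enum_rank (i, j)); rewrite enum_rankK /=.
by move/eqP; rewrite mulf_eq0 => /orP[/eqP//|/eqP].
Qed.

Lemma zero_set_at_near p Z Z' : (\forall q \near p, Z q <-> Z' q) ->
  zero_set_at Z p -> zero_set_at Z' p.
Proof.
move=> ZZ' [U [m [g [pU gU Zg]]]].
exists (U `&` [set q | Z q <-> Z' q]^°), m, g; split.
- by apply: open_nbhsI => //; split; [exact: open_interior | exact: ZZ'].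
- by move=> i; apply: holomorphic_on_sub (gU i) => q [].
- move=> q [Uq /interior_subset /= ZZ'q]; rewrite -Zg //; exact: iff_sym.
Qed.

Lemma zero_set_at_hol p U f : open_nbhs p U -> holomorphic_on U f ->
  zero_set_at [set q | f q = 0] p.
Proof.
move=> pU fU; exists U, 1%N, (fun=> f); split=> // q _; split=> // H; exact: (H ord0).
Qed.

Lemma zero_set_at_near_compl p Z : zero_set_at Z p -> ~ Z p ->
  \forall q \near p, ~ Z q.
Proof.
move=> [U [m [g [pU gU Zg]]]] nZp; have Up : U p by case: pU.
have [i gi] : exists i, g i p != 0.
  apply/not_existsP => H; apply: nZp; apply/Zg => // i.
  by apply/eqP; apply: contraT => gi; case: (H i).
have [c gc] := gU i p Up.
apply: filterS2 (open_nbhs_nbhs pU) (taylor_neq0_near gc gi) => q Uq giq Zq.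
by move/Zg: Zq => /(_ Uq) /(_ i) /eqP; rewrite (negPf giq).
Qed.

Definition thin M S := analytic_subset M S /\ S^° = set0.

(** S is relatively closed in M, so an interior point of the union outside S would be interior to
    S'. The interior of the union thus lies in S, whose interior is empty. *)
Lemma thinU M S S' : thin M S -> thin M S' -> thin M (S `|` S').
Proof.
move=> [[SM Sz] S0] [[SM' Sz'] S0']; split.
  split=> [p [/SM|/SM']//|p Mp]; apply: zero_set_atU; [exact: Sz|exact: Sz'].
rewrite -subset0 => p pI.
have : ~ S^° p by rewrite S0.
move=> nSp; apply: nSp.
have : nbhs p (S `|` S')^° by apply: open_nbhs_nbhs; split => //; exact: open_interior.
apply: filterS => q qI; apply: contrapT => nSq.
have S'q : S' q by have [] := interior_subset qI.
suff : S'^° q by rewrite S0'.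
have nSnear := zero_set_at_near_compl (Sz q (SM' q S'q)) nSq.
by apply: filterS2 qI nSnear => x [].
Qed.

Lemma thin0 M : thin M set0.
Proof.
split; last by rewrite interior0.
split=> // p Mp; exists setT, 1%N, (fun=> fun=> 1); split.
- exact: open_nbhsT.
- by move=> _ q _; exists (fpsC 1); exact: taylor_cst.
- by move=> q _; split=> // /(_ ord0) /eqP; rewrite oner_eq0.
Qed.

Lemma thin_exists M (I : finType) (F : I -> set (C * C)) :
  (forall i, thin M (F i)) -> thin M [set q | exists i, F i q].
Proof.
move=> Fthin.
suff H (s : seq I) : thin M [set q | exists2 i, i \in s & F i q].
  have -> : [set q | exists i, F i q] = [set q | exists2 i, i \in enum I & F i q].
    apply/seteqP; split=> q [k]; first by exists k; rewrite ?mem_enum.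
    by move=> _ Fq; exists k.
  exact: H.
elim: s => [|i s IH].
  have -> : [set q | exists2 i, i \in [::] & F i q] = set0; last exact: thin0.
  by apply/seteqP; split=> q [].
have -> : [set q | exists2 j, j \in i :: s & F j q] =
    F i `|` [set q | exists2 j, j \in s & F j q]; last exact: thinU.
apply/seteqP; split=> q.
  move=> [j]; rewrite inE => /predU1P[->|js] Fq; first by left.
  by right; exists j.
by move=> [Fq|[j js Fq]]; [exists i|exists j]; rewrite ?inE ?eqxx ?js ?orbT.
Qed.

(** The interior of Z is relatively closed in M: near a point of its closure, the local equations
    vanish on a nearby open set, hence around that point. Were it nonempty, connectedness would make
    it all of M, against q. *)
Lemma proper_thin M Z q : domain M -> analytic_subset M Z -> M q -> ~ Z q -> thin M Z.
Proof.
move=> [oM cM _] aZ Mq nZq; split=> //; have [ZM Zz] := aZ.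
apply: contrapT => /eqP/set0P W0; apply: nZq.
have IZ : Z^° `<=` Z := @interior_subset _ Z.
suff ZM' : Z^° = M by apply: IZ; rewrite ZM'.
apply: cM => //.
  exists Z^°; first exact: open_interior.
  by rewrite setIidr // => x /IZ /ZM.
exists (closure Z^°); first exact: closed_closure.
apply/seteqP; split=> [x xI|p [Mp clp]].
  by split; [exact/ZM/IZ | exact: subset_closure].
have [U [m [g [pU gU Zg]]]] := Zz p Mp.
have /nbhs2P [e e0 eU] := open_nbhs_nbhs pU.
have [|z [Wz [z1 z2]]] := clp [set x | `|x.1 - p.1| < e /\ `|x.2 - p.2| < e].
  by apply/nbhs2P; exists e.
have gnear i : \forall x \near p, g i x = 0.
  apply: (@identity_near _ (g i) p e z) => //.
    by move=> x x1 x2; apply: gU; apply: eU.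
  have Unear : \forall x \near z, U x.
    by apply: open_nbhs_nbhs; split; [case: pU | exact: eU].
  have Znear : \forall x \near z, Z x by exact: Wz.
  by apply: filterS2 Unear Znear => x Ux /(Zg x Ux).
have := filter_forall (nbhs_filter p) gnear.
move=> g0; have pUn : nbhs p U := open_nbhs_nbhs pU.
suff : nbhs p Z by [].
by apply: filterS2 pUn g0 => x Ux gx; exact/Zg.
Qed.

End AnalyticSets.

(** * Meromorphic functions *)

Section Meromorphic.
Variables (R : realType) (M : set (R[i] * R[i])).
Local Notation C := R[i].
Hypothesis domM : domain M.
Implicit Types (a : meromorphic M) (p q : C * C).

Let M_nbhs p : M p -> open_nbhs p M.
Proof. by move=> Mp; split=> //; case: domM. Qed.

Lemma polar_thin a : thin M (polar a).
Proof. by case: a. Qed.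

Lemma mero_holomorphic a p : M p -> ~ polar a p -> exists c, taylor setT a p c.
Proof. by case: a => P f aP iP hol quo Mp nPp; exact (hol p (conj Mp nPp)). Qed.

Lemma mero_quotient a p : M p -> exists U (g h : C * C -> C),
  [/\ open_nbhs p U, holomorphic_on U g, holomorphic_on U h
    & forall q, U q -> ~ polar a q -> h q <> 0 /\ a q = g q / h q].
Proof. by case: a => P f aP iP hol quo; exact (quo p). Qed.

Definition coincidence a a' : set (C * C) :=
  polar a `|` polar a' `|` [set q | M q /\ a q = a' q].

(** Off the poles, a = a' means g h' = g' h for local quotients, an equation holomorphic across the
    poles. Adding the polar sets makes the arbitrary values on them irrelevant. *)
Lemma coincidence_analytic a a' : analytic_subset M (coincidence a a').
Proof.
have [[aM aP] _] := polar_thin a; have [[aM' aP'] _] := polar_thin a'.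
split=> [q [[/aM|/aM']//|[]//]|p Mp].
have [U [g [h [pU gU hU agh]]]] := mero_quotient a Mp.
have [U' [g' [h' [pU' gU' hU' agh']]]] := mero_quotient a' Mp.
pose D q := g q * h' q - g' q * h q.
have DU : holomorphic_on (U `&` U') D.
  move=> q [Uq U'q]; have [c1 gc] := gU q Uq; have [c2 hc] := hU q Uq.
  have [c3 gc'] := gU' q U'q; have [c4 hc'] := hU' q U'q.
  by exists (c1 * c4 - c3 * c2); exact: taylorB (taylorM gc hc') (taylorM gc' hc).
have := zero_set_atU (zero_set_atU (aP p Mp) (aP' p Mp))
  (zero_set_at_hol (open_nbhsI pU pU') DU).
apply: zero_set_at_near.
have := open_nbhs_nbhs (open_nbhsI (M_nbhs Mp) (open_nbhsI pU pU')).
apply: filterS => q [Mq [Uq U'q]].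
have DE : ~ polar a q -> ~ polar a' q -> (D q = 0 <-> a q = a' q).
  move=> /(agh q Uq) [/eqP h0 ->] /(agh' q U'q) [/eqP h0' ->]; rewrite /D.
  split=> /eqP; first by rewrite subr_eq0 => E; apply/eqP; rewrite eqr_div.
  by rewrite eqr_div // => /eqP ->; rewrite subrr.
have [Pq|nPq] := pselect (polar a q); first by split=> _; left; left.
have [Pq'|nPq'] := pselect (polar a' q); first by split=> _; left; right.
by split=> [[[]//|/= /DE aq]|[[]//|[_ aq]]]; right=> /=; [split=> //; exact: aq|exact/DE].
Qed.

Lemma coincidence_thin a a' : ~ mero_eq a a' -> thin M (coincidence a a').
Proof.
move=> /existsNP [q] /not_implyP [Mq] /not_implyP [nPq] /not_implyP [nPq'] aa'.
apply: (proper_thin domM (coincidence_analytic a a') Mq).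
by move=> [[]//|[_ /aa']].
Qed.

Definition vertical_line p : set (C * C) := [set q | M q /\ q.1 = p.1].

Lemma taylor_fst p : taylor setT (fun q => q.1 - p.1) p
  (fun i j => if (i == 1%N) && (j == 0%N) then 1 else 0).
Proof.
apply: taylor_near (taylor_monomial 1 1 0 p) _; apply/nbhs2P; exists 1 => // q _ _.
by rewrite mul1r mulr1 expr1.
Qed.

Lemma fst_holomorphic U p : holomorphic_on U (fun q : C * C => q.1 - p.1).
Proof.
move=> q _; have := taylorD (taylor_fst q) (taylor_cst (q.1 - p.1) q).
move=> H; eexists; apply: taylor_near H _; apply/nbhs2P; exists 1 => // x _ _.
by rewrite addrA subrK.
Qed.

Lemma vertical_line_thin p : thin M (vertical_line p).
Proof.
split.
  split=> [q []//|q Mq]; exists M, 1%N, (fun _ x => x.1 - p.1); split.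
  - exact: M_nbhs.
  - by move=> _; exact: fst_holomorphic.
  - move=> x Mx; split=> [[_ ->] _|/(_ ord0)/eqP]; first by rewrite subrr.
    by rewrite subr_eq0 => /eqP.
rewrite -subset0 => q /nbhs2P [e e0 He].
have e2 : `|e / 2| < e.
  by rewrite ger0_norm ?divr_ge0 ?(ltW e0) // gtr_pMr // invf_lt1 // ltr1n.
have [||_ q1] := He (q.1 + e / 2, q.2).
- by rewrite /= addrC addKr.
- by rewrite /= subrr normr0.
have [||_ q1'] := He q; rewrite ?subrr ?normr0 //.
move/eqP: q1; rewrite /= q1' -subr_eq0 addrC addKr mulf_eq0 invr_eq0.
by rewrite (gt_eqF e0) pnatr_eq0.
Qed.

(** Since p is not in Z, the set is just the line near p, a regular point of dimension 1. *)
Lemma line_and_thin_dimension Z p : thin M Z -> M p -> ~ Z p ->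
  has_dimension (vertical_line p `|` Z) 1.
Proof.
move=> Zthin Mp nZp; have [[LM Lz] L0] := thinU (vertical_line_thin p) Zthin.
split; last first.
  move=> e q [_ [k [U [g [c [ke [qU gU gc _ Zg]]]]]]].
  (* With no equation, a whole neighbourhood would lie in the set, which has empty interior. *)
  rewrite leqNgt; apply/negP => e_gt1; have k0 : k = 0%N by lia.
  subst k; suff : (vertical_line p `|` Z)^° q by rewrite L0.
  have := open_nbhs_nbhs qU; apply: filterS => x Ux; apply/Zg => // -[].
  by [].
exists p; split; first by left.
pose U := M `&` [set q | ~ Z q]^°.
have [[ZM Zz] _] := Zthin.
exists 1%N, U, (fun _ q => q.1 - p.1),
  (fun _ i j => if (i == 1%N) && (j == 0%N) then 1 else 0); split=> //; split.
- apply: open_nbhsI; first exact: M_nbhs.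
  split; first exact: open_interior.
  exact: zero_set_at_near_compl (Zz p Mp) nZp.
- by move=> _; exact: fst_holomorphic.
- by move=> _; exact: taylor_fst.
- rewrite /row_free rank_rV; set A := \matrix_(_, _) _.
  suff -> : A != 0 by [].
  apply/eqP => /(congr1 (fun B : 'M_(1, 2) => B 0 0)); rewrite !mxE /=.
  by move/eqP; rewrite oner_eq0.
- move=> q [Mq /interior_subset nZq]; split.
    by move=> [[_ ->] _|/nZq//]; rewrite subrr.
  by move=> /(_ ord0)/eqP; rewrite subr_eq0 => /eqP q1; left.
Qed.

End Meromorphic.

(** * The symbol at a point *)

Section TaylorSymbol.
Variable R : realType.
Local Notation C := R[i].

Lemma taylor_coef_prod_XsubC n (a : 'I_n -> C * C -> C) (A : 'I_n -> fps C) p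
    (s : seq 'I_n) :
  (forall k, taylor setT (a k) p (A k)) -> forall i,
  taylor setT (fun q => (\prod_(k <- s) ('X - (a k q)%:P))`_i) p
    (\prod_(k <- s) ('X - (A k)%:P))`_i.
Proof.
move=> aA; elim: s => [|k s IH] i.
  have := taylor_cst ((i == 0%N)%:R : C) p.
  have -> : (\prod_(k <- [::]) ('X - (A k)%:P))`_i = fpsC (i == 0%N)%:R.
    rewrite big_nil coef1; case: eqP => _ /=.
      by apply: fpsP => k l; rewrite fps_coefC mul1r.
    by apply: fpsP => k l; rewrite fps_coefC mul0r.
  move=> H; apply: taylor_near H _; apply/nbhs2P; exists 1 => // q _ _.
  by rewrite big_nil coef1.
rewrite big_cons mulrBl coefB coefXM coefCM.
have H0 : taylor setT
    (fun q => if i == 0%N then 0 else (\prod_(l <- s) ('X - (a l q)%:P))`_i.-1) p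
    (if i == 0%N then 0 else (\prod_(l <- s) ('X - (A l)%:P))`_i.-1).
  case: eqP => // _; have := taylor_cst (0 : C) p.
  by have -> : fpsC (0 : C) = 0 by apply: fpsP => k' l; rewrite fps_coefC mul0r.
have := taylorB H0 (taylorM (aA k) (IH i)).
move=> H; apply: taylor_near H _; apply/nbhs2P; exists 1 => // q _ _.
by rewrite big_cons mulrBl coefB coefXM coefCM.
Qed.

(** Dehomogenization: eta is evaluated at 1. *)
Lemma symbol_at M n (b : nat -> nat -> meromorphic M) (a : 'I_n -> meromorphic M) q :
  has_symbol b a -> M q ->
  (forall i j, (i + j = n)%N -> ~ polar (b i j) q) ->
  (forall i, ~ polar (a i) q) ->
  \poly_(i < n.+1) b i (n - i)%N q = \prod_(i < n) ('X - (a i q)%:P) :> {poly C}.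
Proof.
move=> ba Mq bq aq.
have := congr1 (map_poly (horner_eval 1)) (ba q Mq bq aq).
rewrite rmorph_sum rmorph_prod poly_def => E.
transitivity (\sum_(i < n.+1) map_poly (horner_eval (1 : C))
    ((b i (n - i)%N q)%:P%:P * 'X ^+ i * 'X%:P ^+ (n - i))).
  apply: eq_bigr => i _; rewrite !rmorphM !rmorphXn /= map_polyX !map_polyC /=.
  by rewrite /horner_eval hornerC hornerX expr1n mulr1 mul_polyC.
rewrite E; apply: eq_bigr => i _; rewrite rmorphB rmorphM /= map_polyX !map_polyC /=.
by rewrite /horner_eval hornerC hornerX mulr1.
Qed.

(** The identity holds between values at all points near p, so uniqueness of Taylor series carries
    it to the series, coefficient by coefficient. *)
Lemma taylor_symbol M n (b : nat -> nat -> meromorphic M) (a : 'I_n -> meromorphic M)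
    p (B : nat -> nat -> fps C) (A : 'I_n -> fps C) :
  has_symbol b a ->
  (\forall q \near p, [/\ M q, forall i j, (i + j = n)%N -> ~ polar (b i j) q
     & forall i, ~ polar (a i) q]) ->
  (forall i j, (i + j <= n)%N -> taylor setT (b i j) p (B i j)) ->
  (forall i, taylor setT (a i) p (A i)) ->
  \poly_(i < n.+1) B i (n - i)%N = \prod_(i < n) ('X - (A i)%:P) :> {poly fps C}.
Proof.
move=> ba good bB aA; apply/polyP => i; rewrite coef_poly.
case: ltnP => [|ni]; last first.
  rewrite nth_default // size_prod_XsubC.
  by rewrite -[index_enum _]enumT size_enum_ord.
rewrite ltnS => i_n; have biB := bB i (n - i)%N; rewrite subnKC // in biB.
apply: taylor_unique (biB (leqnn _)) _.
apply: taylor_near (taylor_coef_prod_XsubC (index_enum 'I_n) aA i) _.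
apply: filterS good => q [Mq bq aq].
by rewrite -(symbol_at ba Mq bq aq) coef_poly ltnS i_n.
Qed.

End TaylorSymbol.

Theorem theorem6p1 (R : realType) (M : set (R[i] * R[i])) (n : nat)
    (b : nat -> nat -> meromorphic M) (a : 'I_n -> meromorphic M) :
  domain M ->
  has_symbol b a ->
  (forall i j : 'I_n, i <> j -> ~ mero_eq (a i) (a j)) ->
  exists S : set (R[i] * R[i]),
    [/\ analytic_subset M S,
        has_dimension S 1
      & forall p : R[i] * R[i], M p -> ~ S p ->
        exists (B : nat -> nat -> fps R[i]) (A : 'I_n -> fps R[i]),
          [/\ forall i j : nat, (i + j <= n)%N -> mero_taylor (b i j) p (B i j),
              forall i : 'I_n, mero_taylor (a i) p (A i),
              exists (f : 'I_n -> fps R[i]) (h : 'I_n -> nat -> fps R[i]),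
                forall i : 'I_n, normalized_solution n B (A i) (f i) (h i)
            & forall (f : 'I_n -> fps R[i]) (h : 'I_n -> nat -> fps R[i]),
                (forall i : 'I_n, normalized_solution n B (A i) (f i) (h i)) ->
                forall u : fps R[i],
                  fps_solution n B u <->
                  exists v : 'I_n -> fps R[i],
                    (forall i : 'I_n, specialization (f i) (h i) (v i)) /\
                    (forall k l : nat, u k l = \sum_(i < n) v i k l)]].
Proof.
move=> domM ba a_neq.
pose Zb := [set q | exists ij : 'I_n.+1 * 'I_n.+1, polar (b ij.1 ij.2) q].
pose Za := [set q | exists i : 'I_n, polar (a i) q].
pose Zc := [set q | exists ij : 'I_n * 'I_n,
  (if ij.1 == ij.2 then set0 else coincidence (a ij.1) (a ij.2)) q].
pose Z := Zb `|` Za `|` Zc.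
have Zthin : thin M Z.
  apply: thinU; first apply: thinU.
  - by apply: thin_exists => ij; exact: polar_thin.
  - by apply: thin_exists => i; exact: polar_thin.
  - apply: thin_exists => ij; case: eqP => [_|ij_neq]; first exact: thin0.
    by apply: coincidence_thin => //; exact: a_neq.
have [[ZM Zz] Z0] := Zthin.
(* The added line passes through a point outside Z, so that it supplies a regular point of dimension
   1. *)
have [p0 Mp0 nZp0] : exists2 p0, M p0 & ~ Z p0.
  have [oM _ [x Mx]] := domM; apply: contrapT => H.
  suff : Z^° x by rewrite Z0.
  have := open_nbhs_nbhs (conj oM Mx : open_nbhs x M); apply: filterS => q Mq.
  by apply: contrapT => nZq; apply: H; exists q.
have [Sana _] := thinU (vertical_line_thin domM p0) Zthin.
exists (vertical_line M p0 `|` Z); split=> //.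
  exact: line_and_thin_dimension.
move=> p Mp nSp; have nZp : ~ Z p by move=> Zp; apply: nSp; right.
have nb q : ~ Z q -> forall i j, (i + j <= n)%N -> ~ polar (b i j) q.
  move=> nZq i j ijn Pq; apply: nZq; left; left.
  have iN : (i < n.+1)%N by lia.
  have jN : (j < n.+1)%N by lia.
  by exists (Ordinal iN, Ordinal jN).
have na q : ~ Z q -> forall i, ~ polar (a i) q.
  by move=> nZq i Pq; apply: nZq; left; right; exists i.
have [B BP] : exists B : nat -> nat -> fps R[i],
    forall i j, (i + j <= n)%N -> taylor setT (b i j) p (B i j).
  have H (ij : nat * nat) : exists c : fps R[i],
      (ij.1 + ij.2 <= n)%N -> taylor setT (b ij.1 ij.2) p c.
    have [ijn|] := boolP (ij.1 + ij.2 <= n)%N; last by exists 0.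
    by have [c bc] := mero_holomorphic Mp (nb p nZp _ _ ijn); exists c.
  have [F FP] := choice H; exists (fun i j => F (i, j)) => i j; exact: (FP (i, j)).
have [A AP] := choice (fun i => mero_holomorphic Mp (na p nZp i)).
have sub_taylor (D : set (R[i] * R[i])) g c : taylor setT g p c -> taylor D g p c.
  by move=> [cB gc]; split=> //; apply: filterS gc => q H _; exact: H.
have symbol : \poly_(i < n.+1) B i (n - i)%N =
    \prod_(i < n) ('X - (A i)%:P) :> {poly fps R[i]}.
  apply: (taylor_symbol ba _ BP AP).
  have nZnear := zero_set_at_near_compl (Zz p Mp) nZp.
  have Mnear : \forall q \near p, M q.
    by apply: open_nbhs_nbhs; split=> //; case: domM.
  apply: filterS2 Mnear nZnear => q Mq nZq; split=> //; last exact: na.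
  by move=> i j ijn; apply: nb => //; rewrite ijn.
(* The constant terms are the values at p, and p lies off every coincidence set. *)
have A_inj : injective (fun i => A i 0%N 0%N).
  move=> i j /=; rewrite -(taylor_val (AP i)) -(taylor_val (AP j)) => aij.
  apply: contrapT => ij; apply: nZp; right; exists (i, j) => /=.
  by rewrite (introF eqP ij); right.
exists B, A; split.
- by move=> i j ijn; apply: sub_taylor; exact: BP.
- by move=> i; apply: sub_taylor; exact: AP.
- have [f fP] := choice (normalized_solution_exists symbol A_inj).
  by have [h hP] := choice fP; exists f, h.
- by move=> f h fh u; exact: (solutionsE u symbol A_inj fh).
Qed.
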